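(* Let $G=(V,E)$ be a locally finite connected weighted graph with measure $\mu\ge\mu_0>0$, let $p\ge 2$, $q\ge 2$, $h_1,h_2:V\to\mathbb{R}$, $F:V\times\mathbb{R}^2\to\mathbb{R}$, $e_1\in L^{\frac{p}{p-1}}(V)$, $e_2\in L^{\frac{q}{q-1}}(V)$ with $e_1\not\equiv0$, $e_2\not\equiv 0$. Assume: (H1) there is a constant $h_0>0$ such that $h_i(x)\ge h_0$ for all $x\in V$, $i=1,2$; (H2) $h_i(x)\to\infty$ as $\mathrm{dist}(x,x_0)\to\infty$ for some fixed $x_0\in V$, $i=1,2$; (F0) $F(x,s,t)$ is continuously differentiable in $(s,t)\in\mathbb{R}^2$ for all $x\in V$, and there are a continuous function $a:[0,\infty)\to[0,\infty)$ and a function $b:V\to[0,\infty)$ with $b\in L^1(V)$ such that $|F_s(x,s,t)|\le a(|(s,t)|)b(x)$, $|F_t(x,s,t)|\le a(|(s,t)|)b(x)$ and $|F(x,s,t)|\le a(|(s,t)|)b(x)$ for all $x\in V$, $(s,t)\in\mathbb{R}^2$; (F1) $F(x,0,0)=0$ for all $x\in V$, and there are $f_1,f_2,g_1,g_2:V\to[0,\infty)$ with $g_1\in L^{\frac{p}{p-1}}(V)$, $g_2\in L^{\frac{q}{q-1}}(V)$, $\|f_1\|_\infty<\min\left\{\frac{h_0}{2},\frac{ph_0}{q(p-1)}\right\}$ and $\|f_2\|_\infty<h_0-\frac{q(p-1)}{p}\|f_1\|_\infty$ such that $$|F_s(x,s,t)|\le f_1(x)\left(|s|^{p-1}+|t|^{\frac{pq-q}{p}}\right)+g_1(x),\qquad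 |F_t(x,s,t)|\le f_2(x)\left(|s|^p+|t|^{q-1}\right)+g_2(x)$$ for all $x\in V$ and $(s,t)\in\mathbb{R}^2$; (F2) at least one of the following holds: (i) there are $\beta_1>1$ and $K_1:V\to\mathbb{R}$ such that $K_1(x_1)>0$ for some $x_1\in V$ with $e_1(x_1)>0$, and $F(x,s,0)\ge -K_1(x)|s|^{\beta_1}$ for all $s\in\mathbb{R}$, $x\in V$; (ii) there are $\beta_2>1$ and $K_2:V\to\mathbb{R}$ such that $K_2(x_2)>0$ for some $x_2\in V$ with $e_2(x_2)>0$, and $F(x,0,t)\ge -K_2(x)|t|^{\beta_2}$ for all $t\in\mathbb{R}$, $x\in V$. Then for each $(\lambda_1,\lambda_2)\in(0,+\infty)\times(0,+\infty)$ the system $$\begin{cases}-\Delta_p u+h_1(x)|u|^{p-2}u=F_u(x,u,v)+\lambda_1e_1(x),& x\in V,\\ -\Delta_q v+h_2(x)|v|^{q-2}v=F_v(x,u,v)+\lambda_2e_2(x),& x\in V,\end{cases}$$ has at least one nontrivial solution $(u_{\lambda\star},v_{\lambda\star})\neq(0,0)$. Furthermore, if $(u_{\lambda\star},v_{\lambda\star})=(u_{\lambda\star},0)$, then $$\|u_{\lambda\star}\|_\infty\le\mu_0^{-\frac1p}\left(\frac{\lambda_1\|e_1\|_{L^{\frac{p}{p-1}}(V)}+\|g_1\|_{L^{\frac{p}{p-1}}(V)}}{h_0-\|f_1\|_\infty}\right)^{\frac{1}{p-1}},$$ and if $(u_{\lambda\star},v_{\lambda\star})=(0,v_{\lambda\star})$,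 then $$\|v_{\lambda\star}\|_\infty\le\mu_0^{-\frac1q}\left(\frac{\lambda_2\|e_2\|_{L^{\frac{q}{q-1}}(V)}+\|g_2\|_{L^{\frac{q}{q-1}}(V)}}{h_0-\|f_2\|_\infty}\right)^{\frac{1}{q-1}}.$$
   Context: Graph setting: $G=(V,E)$ is locally finite (each vertex lies on finitely many edges) and connected; each edge $xy\in E$ has a weight $\omega_{xy}=\omega_{yx}>0$; $y\sim x$ means $xy\in E$; $\mathrm{dist}(x,y)$ is the minimal number of edges connecting $x$ and $y$; $\mu:V\to(0,\infty)$ satisfies $\mu(x)\ge\mu_0>0$ for all $x$. Write $\int_V u\,d\mu=\sum_{x\in V}u(x)\mu(x)$, $\|u\|_{L^r(V)}=(\int_V|u|^rd\mu)^{1/r}$, $\|u\|_\infty=\sup_{V}|u|$. For $u,v:V\to\mathbb{R}$: $\Gamma(u,v)(x)=\frac{1}{2\mu(x)}\sum_{y\sim x}\omega_{xy}(u(y)-u(x))(v(y)-v(x))$, $|\nabla u|(x)=\sqrt{\Gamma(u,u)(x)}$, and for $p\ge2$ (with $|\cdot|^0=1$ if $p=2$) $$\Delta_pu(x)=\frac{1}{2\mu(x)}\sum_{y\sim x}\left(|\nabla u|^{p-2}(y)+|\nabla u|^{p-2}(x)\right)\omega_{xy}(u(y)-u(x)).$$ $C_c(V)$ is the set of finitely supported functions $V\to\mathbb{R}$. $W^{1,s}(V)$ is the completion of $C_c(V)$ under $\|u\|_{W^{1,s}(V)}=(\int_V|\nabla u|^s+|u|^s\,d\mu)^{1/s}$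 (a space of functions on $V$). For $h\ge h_0>0$, $W_h^{1,s}(V)=\{u\in W^{1,s}(V):\int_Vh|u|^sd\mu<\infty\}$ with norm $\|u\|_{W_h^{1,s}(V)}=(\int_V|\nabla u|^s+h|u|^sd\mu)^{1/s}$. Let $W=W_{h_1}^{1,p}(V)\times W_{h_2}^{1,q}(V)$. A solution of the system is a pair $(u,v)\in W$ satisfying both equations at every $x\in V$; it is nontrivial if $(u,v)\ne(0,0)$. $F_u,F_v$ (also $F_s,F_t$) are the partial derivatives of $F$ in its second and third variables; $|(s,t)|$ is the Euclidean norm. *)

(* Defs.v *)
From HB Require Import structures.
From mathcomp Require Import all_boot all_order all_algebra.
From mathcomp Require Import all_classical all_reals all_analysis.

Set Implicit Arguments.
Unset Strict Implicit.
Unset Printing Implicit Defensive.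

Import Order.TTheory GRing.Theory Num.Theory.
Import numFieldNormedType.Exports.

Local Open Scope classical_set_scope.
Local Open Scope ring_scope.

(* Only the values [weight G x y] with [adj G x y] are meaningful. *)
Record wgraph (R : realType) (V : choiceType) := WGraph {
  adj : rel V ;
  weight : V -> V -> R ;
  mu : V -> R ;
  adj_sym : symmetric adj ;
  weight_sym : forall x y, adj x y -> weight x y = weight y x ;
  weight_gt0 : forall x y, adj x y -> 0 < weight x y ;
  mu_gt0 : forall x, 0 < mu x ;
  locally_finite : forall x, finite_set [set y | adj x y] ;
  graph_connected : forall x y, exists s, path adj x s /\ last x s = y }.

Section Graph.
Variables (R : realType) (V : choiceType) (G : wgraph R V).
Implicit Types (u v f : V -> R) (x y : V) (r s p : R).

Definition walk_of_length x y (n : nat) : Prop :=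
  exists w, [/\ path (adj G) x w, last x w = y & size w = n].

Lemma ex_walk_length x y : exists n, `[< walk_of_length x y n >].
Proof.
have [w [pw lw]] := graph_connected G x y.
by exists (size w); apply/asboolP; exists w.
Qed.

Definition dist x y : nat := ex_minn (ex_walk_length x y).

(* [\esum] is the supremum of the finite partial sums, hence this is the
   integral only for nonnegative [f], the only case in which it is used. *)
Definition gint f : \bar R := (\esum_(x in [set: V]) (f x * mu G x)%:E)%E.

Definition LnormV r u : \bar R := poweR (gint (fun x => `|u x| `^ r)) r^-1.

Definition inL r u : Prop := (LnormV r u < +oo)%E.

(* An extended real, [-oo] only when [V] is empty. *)
Definition supnorm u : \bar R := ereal_sup [set `|u x|%:E | x in [set: V]].

Definition Gamma u v x : R :=
  (2 * mu G x)^-1 *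
    \sum_(y \in [set y | adj G x y])
      weight G x y * (u y - u x) * (v y - v x).

Definition grad u x : R := Num.sqrt (Gamma u u x).

(* [a `^ 0 = 1] for every [a], including [a = 0]. *)
Definition pLaplacian p u x : R :=
  (2 * mu G x)^-1 *
    \sum_(y \in [set y | adj G x y])
      (grad u y `^ (p - 2) + grad u x `^ (p - 2)) *
        weight G x y * (u y - u x).

Definition Cc u : Prop := finite_set [set x | u x != 0].

Definition sobolev_norm s u : \bar R :=
  poweR (gint (fun x => grad u x `^ s + `|u x| `^ s)) s^-1.

Definition sobolev_cauchy s (phi : nat -> V -> R) : Prop :=
  forall e : R, 0 < e -> exists N : nat, forall m n : nat,
    (N <= m)%N -> (N <= n)%N ->
    (sobolev_norm s (fun x => phi m x - phi n x)%R < e%:E)%E.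

(* The completion of C_c(V) realized as a space of functions: when [mu] is
   bounded below by a positive constant, a Cauchy sequence of C_c(V) converges
   pointwise, and two such sequences are equivalent if and only if their
   pointwise limits coincide, so that a point of the completion is the same
   thing as the pointwise limit of a Cauchy sequence of C_c(V). *)
Definition sobolev s u : Prop :=
  exists phi : nat -> V -> R,
    [/\ forall n, Cc (phi n),
        sobolev_cauchy s phi &
        forall x, phi n x @[n --> \oo] --> u x].

Definition sobolev_weighted (h : V -> R) s u : Prop :=
  sobolev s u /\ (gint (fun x => h x * `|u x| `^ s)%R < +oo)%E.

Definition coercive_potential (h : V -> R) x0 : Prop :=
  forall M : R, exists N : nat, forall x, (N <= dist x x0)%N -> M <= h x.

End Graph.

Section Nonlinearity.
Variables (R : realType) (V : Type) (F : V -> R -> R -> R).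

Definition Fs x s t : R := derive1 (fun s' : R => F x s' t) s.
Definition Ft x s t : R := derive1 (fun t' : R => F x s t') t.

Definition C1_in_st : Prop := forall x,
  [/\ forall z : R * R, differentiable (fun z : R * R => F x z.1 z.2) z,
      continuous (fun z : R * R => Fs x z.1 z.2) &
      continuous (fun z : R * R => Ft x z.1 z.2)].

Definition enorm (s t : R) : R := Num.sqrt (s ^+ 2 + t ^+ 2).

End Nonlinearity.

Section System.
Variables (R : realType) (V : choiceType) (G : wgraph R V) (p q : R).
Variables (h1 h2 e1 e2 : V -> R) (F : V -> R -> R -> R) (lambda1 lambda2 : R).

Definition solution (u v : V -> R) : Prop :=
  [/\ sobolev_weighted G h1 p u,
      sobolev_weighted G h2 q v,
      forall x, - pLaplacian G p u x + h1 x * `|u x| `^ (p - 2) * u x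
                = Fs F x (u x) (v x) + lambda1 * e1 x &
      forall x, - pLaplacian G q v x + h2 x * `|v x| `^ (q - 2) * v x
                = Ft F x (u x) (v x) + lambda2 * e2 x].

End System.

(* Main.v *)
Require Import Defs.
From HB Require Import structures.
From mathcomp Require Import all_boot all_order all_algebra.
From mathcomp Require Import finmap.
From mathcomp Require Import all_classical all_reals all_analysis.
From mathcomp Require Import ring lra.

Set Implicit Arguments.
Unset Strict Implicit.
Unset Printing Implicit Defensive.

Import Order.TTheory GRing.Theory Num.Theory.
Import numFieldNormedType.Exports.

Local Open Scope classical_set_scope.
Local Open Scope ring_scope.

(** The solution is a minimiser of the energy over pairs of functions that are
    limits of finitely supported ones. Young's inequality shows that, after adding
    a fixed integrable function, the integrand is nonnegative and controls
    [|grad u|^p + h1 |u|^p + |grad v|^q + h2 |v|^q]; hence the energy is lower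
    semicontinuous for pointwise convergence (Fatou) and its sublevel sets lie in a
    product of compact intervals, so Tychonoff yields a candidate. Clarkson's
    inequality shows that it is still a limit of finitely supported functions.
    Perturbing the minimiser at one vertex changes finitely many terms and gives
    the equations. By (F2) the pair [(0, 0)] violates one of them. For the bound on
    [u] when [v = 0], compare the energies of [u] and [t u] for [t < 1], and apply
    Hölder's inequality. *)

(** * Powers and integrals *)

(** [gint] is a supremum of finite sums and represents the integral only for nonnegative integrands,
    whereas the energy density has no sign. The integrable shift repairs this without changing any
    derivative in the unknowns, so that infima and comparisons take place in [[0, +oo]].
    Inequalities between integrals are arranged with nonnegative terms on both sides, and only
    finite quantities are cancelled.

    Convergence is pointwise throughout, in place of weak convergence in a reflexive space. The
    obstacle is that a pointwise limit of finitely supported functions need not lie in the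
    completion; the energy bound together with uniform convexity restores this.

    Both components go through the same scalar lemmas: with the other component frozen, the
    integrand is the energy of one function plus an arbitrary potential [Psi]. The smallness
    conditions on [f1] and [f2] enter the coercivity estimate as 2A1 < h0 and q(p-1)/p A1 + A2 < h0,
    where A1 and A2 are the sup norms: Young's inequality applied to the mixed term of the growth of
    F_s doubles A1 in front of |u|^p and adds q(p-1)/p A1 to A2 in front of |v|^q. *)

Section PowR.
Variable R : realType.
Implicit Types (a b c d x y r p q : R).

(** Each power splits as z^r = z z^(r-1), and the second factor is at most (x+y)^(r-1). *)
Lemma powR_superadditive x y r : 1 <= r -> 0 <= x -> 0 <= y ->
  x `^ r + y `^ r <= (x + y) `^ r.
Proof.
move=> r1 x0 y0; have r0 : 0 < r by lra.
have xy0 : 0 <= x + y by rewrite addr_ge0.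
have key z : 0 <= z -> z <= x + y -> z `^ r <= z * (x + y) `^ (r - 1).
  move=> z0 zxy; rewrite -(mulr_powRB1 z0 r0) ler_wpM2l//.
  by apply: ge0_ler_powR; rewrite ?nnegrE//; lra.
rewrite -[leRHS]mulr_powRB1// mulrDl lerD// key//; lra.
Qed.

Lemma powR_midpoint x y r : 1 <= r -> 0 <= x -> 0 <= y ->
  ((x + y) / 2) `^ r <= (x `^ r + y `^ r) / 2.
Proof.
move=> r1 x0 y0.
have h0 : (0 : R) <= 2^-1 by lra.
have h1 : (2^-1 : R) <= 1 by lra.
have hh : unstable.onem 2^-1 = 2^-1 :> R by rewrite /unstable.onem; lra.
have := @convex_powR R r r1 (Itv01 h0 h1) x y.
rewrite !inE /= !in_itv/= !andbT => /(_ x0 y0).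
rewrite convRE [X in X `^ _]convRE /= hh.
by rewrite -!mulrDr !(mulrC 2^-1).
Qed.

(** Superadditivity followed by convexity of the power. With r = p/2 and squares for a, b, c, d, the
    hypothesis is the parallelogram law and the conclusion is Clarkson's inequality for p at least
    2. *)
Lemma powR_clarkson a b c d r : 1 <= r -> 0 <= a -> 0 <= b -> 0 <= c -> 0 <= d ->
  c + d = (a + b) / 2 -> c `^ r + d `^ r <= (a `^ r + b `^ r) / 2.
Proof.
move=> r1 a0 b0 c0 d0 cd.
by rewrite (le_trans (powR_superadditive r1 c0 d0))// cd powR_midpoint.
Qed.

Lemma sqr_powR x p : (x ^+ 2) `^ (p / 2) = `|x| `^ p.
Proof.
rewrite -(real_normK (num_real x)) -powR_mulrn// -powRrM.
by congr powR; field.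
Qed.

Lemma sqrt_powR x p : 0 <= x -> Num.sqrt x `^ p = x `^ (p / 2).
Proof. by move=> x0; rewrite -powR12_sqrt// -powRrM mulrC. Qed.

(** Either g is at most k s^(p-1), and the first term alone suffices, or s is at most
    (g/k)^(1/(p-1)), and the second one does; the latter case dictates [C]. *)
Lemma young_scaled k p : 1 < p -> 0 < k -> exists2 C : R, 0 <= C &
  forall g s, 0 <= g -> 0 <= s -> g * s <= k * s `^ p + C * g `^ (p / (p - 1)).
Proof.
move=> p1 k0; exists (k `^ (- (p - 1)^-1)); first exact: powR_ge0.
move=> g s g0 s0; have p10 : 0 < p - 1 by lra.
have [gs|gs] := leP g (k * s `^ (p - 1)).
  apply: ler_wpDr; first by rewrite mulr_ge0// powR_ge0.
  have p0 : 0 < p by lra.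
  rewrite -(mulr_powRB1 s0 p0).
  by rewrite mulrCA [leLHS]mulrC ler_wpM2l.
apply: ler_wpDl; first by rewrite mulr_ge0 ?powR_ge0 ?ltW.
have gk0 : 0 <= g / k by rewrite divr_ge0// ltW.
have sle : s <= (g / k) `^ (p - 1)^-1.
  have -> : s = (s `^ (p - 1)) `^ (p - 1)^-1.
    by rewrite -powRrM mulfV ?powRr1// gt_eqF.
  apply: ge0_ler_powR; rewrite ?nnegrE ?powR_ge0 ?invr_ge0 ?(ltW p10)//.
  by rewrite ler_pdivlMr// mulrC ltW.
have -> : p / (p - 1) = 1 + (p - 1)^-1 by field; exact: lt0r_neq0.
apply: (le_trans (ler_wpM2l g0 sle)).
have [->|gn0] := eqVneq g 0; first by rewrite mul0r mulr_ge0 ?powR_ge0.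
rewrite powRD ?gn0 ?implybT// powRr1// powRM ?invr_ge0 ?(ltW k0)//.
rewrite -[k^-1]powR_inv1 ?(ltW k0)// -powRrM mulN1r.
by rewrite le_eqVlt; apply/orP; left; apply/eqP; ring.
Qed.

End PowR.

(** * Integrals as suprema of finite sums *)

Section Gint.
Variables (R : realType) (V : choiceType) (G : wgraph R V).
Implicit Types (f g : V -> R) (A : {fset V}).

(** The interface between the extended-valued integral and real arithmetic: upper bounds are proved
    and used on finite sums. *)
Lemma gint_le_sumP f (M : R) :
  (gint G f <= M%:E)%E <-> forall A : {fset V}, \sum_(x <- A) f x * mu G x <= M.
Proof.
split=> [le A|le].
  rewrite -lee_fin; apply: le_trans le.
  apply: esum_ge; exists [set` A]; first by split.
  by rewrite fsbig_finite//= set_fsetK sumEFin.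
apply: ge_ereal_sup => _ [A [finA _] <-].
by rewrite fsbig_finite//= sumEFin lee_fin.
Qed.

Lemma le_gint f g : (forall x, f x <= g x) -> (gint G f <= gint G g)%E.
Proof.
move=> fg; apply: le_esum => x _.
by rewrite lee_fin ler_wpM2r// ltW// mu_gt0.
Qed.

Lemma eq_gint f g : (forall x, f x = g x) -> gint G f = gint G g.
Proof. by move=> fg; congr gint; apply/funext. Qed.

Lemma gint_ge0 f : (forall x, 0 <= f x) -> (0 <= gint G f)%E.
Proof. by move=> f0; apply: esum_ge0 => x _; rewrite lee_fin mulr_ge0// ltW// mu_gt0. Qed.

Lemma gintD f g : (forall x, 0 <= f x) -> (forall x, 0 <= g x) ->
  gint G (fun x => f x + g x) = (gint G f + gint G g)%E.
Proof.
move=> f0 g0; rewrite /gint -esumD; first by apply: eq_esum => x _; rewrite mulrDl EFinD.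
  by move=> x _; rewrite lee_fin mulr_ge0// ltW// mu_gt0.
by move=> x _; rewrite lee_fin mulr_ge0// ltW// mu_gt0.
Qed.

Lemma gint_scale_le f (c M : R) : 0 <= c -> (gint G f <= M%:E)%E ->
  (gint G (fun x => c * f x)%R <= (c * M)%:E)%E.
Proof.
move=> c0 /gint_le_sumP fM; apply/gint_le_sumP => A.
under eq_bigr do rewrite -mulrA.
by rewrite -mulr_sumr ler_wpM2l.
Qed.

Lemma gint_fineK f : (forall x, 0 <= f x) -> (gint G f < +oo)%E ->
  (fine (gint G f))%:E = gint G f.
Proof. by move=> f0 foo; rewrite fineK// ge0_fin_numE// gint_ge0. Qed.

Lemma gint_ubP f : (forall x, 0 <= f x) ->
  (gint G f < +oo)%E <-> exists M : R, (gint G f <= M%:E)%E.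
Proof.
move=> f0; split=> [foo|[M fM]]; last by rewrite (le_lt_trans fM)// ltry.
by exists (fine (gint G f)); rewrite gint_fineK.
Qed.

Lemma gint_lty_scale f (c : R) : 0 <= c -> (forall x, 0 <= f x) ->
  (gint G f < +oo)%E -> (gint G (fun x => c * f x)%R < +oo)%E.
Proof.
move=> c0 f0 /gint_ubP [//|M fM]; apply/gint_ubP.
  by move=> x; rewrite mulr_ge0.
by exists (c * M); exact: gint_scale_le.
Qed.

Lemma gint_lty_add f g : (forall x, 0 <= f x) -> (forall x, 0 <= g x) ->
  (gint G f < +oo)%E -> (gint G g < +oo)%E ->
  (gint G (fun x => f x + g x)%R < +oo)%E.
Proof. by move=> f0 g0 foo goo; rewrite gintD// lte_add_pinfty. Qed.

Lemma mul_mu_le_gint f x (M : R) : (forall y, 0 <= f y) ->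
  (gint G f <= M%:E)%E -> f x * mu G x <= M.
Proof.
by move=> f0 /gint_le_sumP /(_ [fset x]%fset); rewrite big_seq_fset1.
Qed.

(** Fatou's lemma for closures instead of sequences: each finite partial sum is continuous, so the
    set where it is at most [M] is closed. This form applies directly to cluster points. *)
Lemma closure_gint_le (T : topologicalType) (S : set T) (K : T -> V -> R)
    (z : T) (M : R) : (forall x, continuous (K^~ x)) ->
  closure S z -> (forall w, S w -> (gint G (K w) <= M%:E)%E) ->
  (gint G (K z) <= M%:E)%E.
Proof.
move=> Kc Sz SM; apply/gint_le_sumP => A.
pose k w := \sum_(x <- A) K w x * mu G x.
have kc : continuous k.
  move=> w; rewrite /k; elim: (enum_fset A) => [|x s IH].
    under eq_fun do rewrite big_nil. exact: cvg_cst.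
  under eq_fun do rewrite big_cons.
  by apply: (@cvgD R R^o) => //; apply: cvgM; [exact: Kc|exact: cvg_cst].
have cl : closed (k @^-1` [set r | r <= M]).
  by apply: preimage_closed => //; exact: closed_le.
suff : closure S `<=` k @^-1` [set r | r <= M] by apply.
rewrite [X in _ `<=` X](iffLR (closure_id _) cl); apply: closureS => w Sw.
by have /gint_le_sumP := SM _ Sw; exact.
Qed.

End Gint.

(** * Limits of finitely supported functions *)

Section Continuity.
Variable R : realType.

Lemma continuous_norm_powR (r : R) : 0 < r -> continuous (fun y : R => `|y| `^ r).
Proof.
(* The origin is treated by hand, since the power is differentiable only at positive points. *)
move=> r0 y; have [->|y0] := eqVneq y 0.
  rewrite /continuous_at normr0 powR0 ?gt_eqF//; apply/(@cvgrPdist_lt R R^o) => e e0.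
  have er0 : 0 < e `^ r^-1 by rewrite powR_gt0.
  near=> z; rewrite sub0r normrN ger0_norm ?powR_ge0//.
  have zlt : `|z| < e `^ r^-1 by near: z; exact: (@nbhs0_lt R R^o).
  rewrite [ltRHS](_ : e = (e `^ r^-1) `^ r).
    by apply: gt0_ltr_powR; rewrite ?nnegrE ?powR_ge0.
  by rewrite -powRrM mulVf ?powRr1 ?(ltW e0)// gt_eqF.
apply: (@continuous_comp _ _ _ (fun y : R => `|y|) (fun y => y `^ r)).
  exact: norm_continuous.
have ay : `|y| \in `]0, +oo[%R by rewrite in_itv/= andbT normr_gt0.
by apply: differentiable_continuous; apply/derivable1_diffP; exact: derivable_powR.
Unshelve. all: by end_near. Qed.

Lemma ptws_continuous (V : choiceType) (S : topologicalType)
    (phi : S -> {ptws V -> R}) :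
  (forall x, continuous (fun w => phi w x)) -> continuous phi.
Proof.
move=> H s; apply/cvg_sup => x A [B [[W oW <-]] /= Ws] /filterS; apply.
by apply: H; exact: open_nbhs_nbhs.
Qed.

Lemma ptws_eval_continuous (V : choiceType) (x : V) :
  continuous (fun u : {ptws V -> R} => u x).
Proof. exact: (@proj_continuous V (fun=> R) x). Qed.

Lemma continuous_midpoint (T : topologicalType) (f g : T -> R) :
  continuous f -> continuous g -> continuous (fun z => (f z + g z) / 2).
Proof.
move=> fc gc z; apply: cvgM; last exact: cvg_cst.
by apply: (@cvgD R R^o); [exact: fc|exact: gc].
Qed.

Lemma continuous_half_sub (T : topologicalType) (f g : T -> R) :
  continuous f -> continuous g -> continuous (fun z => (f z - g z) / 2).
Proof.
move=> fc gc; apply: continuous_midpoint => // z.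
by apply: (@cvgN R R^o); exact: gc.
Qed.

End Continuity.

(** * Clarkson's inequality and approximation by finitely supported functions *)

Section Density.
Variables (R : realType) (V : choiceType) (G : wgraph R V).
Implicit Types (u v phi : V -> R) (x y : V) (p c : R).

(** A finite set rather than a predicate, so that sums over neighbours are ordinary big
    operators. *)
Definition nbr x : {fset V} := fset_set [set y | adj G x y].

Lemma in_nbr x y : (y \in nbr x) = adj G x y.
Proof.
rewrite in_fset_set ?inE//=; last exact: locally_finite.
by apply/idP/idP => [/set_mem|/mem_set].
Qed.

Lemma GammaE u v x : Gamma G u v x = (2 * mu G x)^-1 *
  \sum_(y <- nbr x) weight G x y * (u y - u x) * (v y - v x).
Proof. by rewrite /Gamma fsbig_finite//; exact: locally_finite. Qed.

Let mu2V_gt0 x : 0 < (2 * mu G x)^-1.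
Proof. by rewrite invr_gt0 mulr_gt0// mu_gt0. Qed.

Lemma Gamma_ge0 u x : 0 <= Gamma G u u x.
Proof.
rewrite GammaE mulr_ge0 ?(ltW (mu2V_gt0 x))// big_seq sumr_ge0// => y.
rewrite in_nbr => /(weight_gt0) w0; rewrite -mulrA mulr_ge0 ?(ltW w0)//.
by rewrite -expr2 sqr_ge0.
Qed.

Lemma grad_powR p u x : grad G u x `^ p = Gamma G u u x `^ (p / 2).
Proof. by rewrite sqrt_powR// Gamma_ge0. Qed.

Lemma Gamma_parallelogram u v x :
  Gamma G (fun y => (u y + v y) / 2) (fun y => (u y + v y) / 2) x +
  Gamma G (fun y => (u y - v y) / 2) (fun y => (u y - v y) / 2) x =
  (Gamma G u u x + Gamma G v v x) / 2.
Proof.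
rewrite !GammaE -!mulrDr -mulrA; congr (_ * _).
rewrite -!big_split mulr_suml /=; by apply: eq_bigr => y _; field.
Qed.

Lemma Gamma_scale c u x :
  Gamma G (fun y => c * u y) (fun y => c * u y) x = c ^+ 2 * Gamma G u u x.
Proof.
rewrite !GammaE mulrCA; congr (_ * _).
rewrite mulr_sumr; apply: eq_bigr => y _; ring.
Qed.

(** The integrand of the p-th power of [sobolev_norm]; working with it postpones the root to the
    final comparison with [sobolev]. *)
Definition dens p u x := grad G u x `^ p + `|u x| `^ p.

Lemma dens_ge0 p u x : 0 <= dens p u x.
Proof. by rewrite addr_ge0// powR_ge0. Qed.

Lemma dens_scale p c u x : dens p (fun y => c * u y) x = `|c| `^ p * dens p u x.
Proof.
rewrite /dens !grad_powR Gamma_scale (powRM _ (sqr_ge0 c) (Gamma_ge0 u x)).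
by rewrite sqr_powR normrM (powRM _ (normr_ge0 c) (normr_ge0 _)) mulrDr.
Qed.

(** Both [Gamma G u u x] and the square of [u x] are quadratic in [u], hence obey the parallelogram
    law; [powR_clarkson] with exponent p/2 applies to each separately. *)
Lemma dens_clarkson p u v x : 2 <= p ->
  dens p (fun y => (u y + v y) / 2) x + dens p (fun y => (u y - v y) / 2) x <=
  (dens p u x + dens p v x) / 2.
Proof.
move=> p2; have p21 : 1 <= p / 2 by lra.
rewrite /dens !grad_powR addrACA.
rewrite [leRHS](_ : _ = (Gamma G u u x `^ (p / 2) + Gamma G v v x `^ (p / 2)) / 2 +
  (`|u x| `^ p + `|v x| `^ p) / 2); last by field.
apply: lerD.
  exact: (powR_clarkson p21 (Gamma_ge0 _ _) (Gamma_ge0 _ _) (Gamma_ge0 _ _)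
    (Gamma_ge0 _ _) (Gamma_parallelogram u v x)).
rewrite -!sqr_powR; apply: powR_clarkson; rewrite ?sqr_ge0//.
by field.
Qed.

Lemma dens0 p x : 0 < p -> dens p (cst 0) x = 0.
Proof.
move=> p0; rewrite /dens grad_powR GammaE big1 => [|y _]; last by rewrite subrr !mulr0.
by rewrite mulr0 normr0 !powR0 ?addr0 ?gt_eqF// divr_gt0.
Qed.

Lemma gint_dens_clarkson p u v (A B : R) : 2 <= p ->
  (gint G (dens p u) <= A%:E)%E -> (gint G (dens p v) <= B%:E)%E ->
  (gint G (dens p (fun y => (u y + v y) / 2)%R) +
   gint G (dens p (fun y => (u y - v y) / 2)%R) <= ((A + B) / 2)%:E)%E.
Proof.
move=> p2 uA vB; rewrite -gintD; do ?exact: dens_ge0.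
apply: (@le_trans _ _ (gint G (fun x => 2^-1 * (dens p u x + dens p v x))%R)).
  by apply: le_gint => x; rewrite [leRHS]mulrC dens_clarkson.
rewrite mulrC; apply: gint_scale_le; first by rewrite invr_ge0.
by rewrite gintD ?EFinD ?leeD//; exact: dens_ge0.
Qed.

Lemma gint_dens_scale p c u (M : R) : (gint G (dens p u) <= M%:E)%E ->
  (gint G (dens p (fun y => c * u y)%R) <= (`|c| `^ p * M)%:E)%E.
Proof.
move=> uM; rewrite (eq_gint G (dens_scale p c u)).
by rewrite gint_scale_le ?powR_ge0.
Qed.

(** The sum is twice the midpoint, which Clarkson's inequality controls. This quasi-triangle
    inequality takes the place of Minkowski's. *)
Lemma gint_dens_add p u v (A B : R) : 2 <= p ->
  (gint G (dens p u) <= A%:E)%E -> (gint G (dens p v) <= B%:E)%E ->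
  (gint G (dens p (fun y => u y + v y)%R) <= (2 `^ p * ((A + B) / 2))%:E)%E.
Proof.
move=> p2 uA vB.
have mid : (gint G (dens p (fun y => (u y + v y) / 2)%R) <= ((A + B) / 2)%:E)%E.
  apply: le_trans (gint_dens_clarkson p2 uA vB).
  by rewrite leeDl// gint_ge0//; exact: dens_ge0.
have := gint_dens_scale 2 mid; rewrite (ger0_norm (ler0n R 2)).
rewrite (_ : (fun y => 2 * _) = (fun y => u y + v y))//.
by apply/funext => y; field.
Qed.

Lemma grad_powR_continuous p (S : topologicalType) (psi : S -> V -> R) : 0 < p ->
  (forall x, continuous (fun w => psi w x)) ->
  forall x, continuous (fun w => grad G (psi w) x `^ p).
Proof.
move=> p0 psic x w.
suff : grad G (psi w') x `^ p @[w' --> w] --> grad G (psi w) x `^ p by [].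
have Gc : Gamma G (psi w') (psi w') x @[w' --> w] --> Gamma G (psi w) (psi w) x.
  under eq_fun do rewrite GammaE.
  rewrite GammaE; apply: cvgM; first exact: cvg_cst.
  elim: (enum_fset (nbr x)) => [|y s IH].
    by rewrite big_nil; under eq_fun do rewrite big_nil; exact: cvg_cst.
  rewrite big_cons; under eq_fun do rewrite big_cons.
  apply: (@cvgD R R^o) => //.
  by apply: cvgM; [apply: cvgM; [exact: cvg_cst|]|]; apply: (@cvgB R R^o); exact: psic.
have gE u : grad G u x `^ p = `|Gamma G u u x| `^ (p / 2).
  by rewrite grad_powR ger0_norm ?Gamma_ge0.
under eq_fun do rewrite gE.
have p20 : 0 < p / 2 by rewrite divr_gt0.
rewrite gE; apply: (@cvg_comp _ _ _ (fun w' => Gamma G (psi w') (psi w') x)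
  (fun y : R => `|y| `^ (p / 2)) _ _ _ Gc).
exact: (continuous_norm_powR p20).
Qed.

Lemma norm_powR_continuous p (S : topologicalType) (psi : S -> V -> R) : 0 < p ->
  (forall x, continuous (fun w => psi w x)) ->
  forall x, continuous (fun w => `|psi w x| `^ p).
Proof.
move=> p0 psic x w.
apply: (@continuous_comp _ _ _ (fun w => psi w x) (fun y : R => `|y| `^ p)).
  exact: psic.
exact: continuous_norm_powR.
Qed.

Lemma dens_continuous p (S : topologicalType) (psi : S -> V -> R) : 0 < p ->
  (forall x, continuous (fun w => psi w x)) ->
  forall x, continuous (fun w => dens p (psi w) x).
Proof.
move=> p0 psic x w; apply: (@cvgD R R^o).
  exact: (@grad_powR_continuous p S psi p0 psic x).
exact: (@norm_powR_continuous p S psi p0 psic x).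
Qed.

Lemma Cc_comb u v (a b : R) : Cc u -> Cc v -> Cc (fun x => a * u x + b * v x).
Proof.
move=> uc vc; apply: (@sub_finite_set _ _ ([set x | u x != 0] `|` [set x | v x != 0])).
  move=> x /=; have [->|] := eqVneq (u x) 0; last by left.
  have [->|] := eqVneq (v x) 0; last by right.
  by rewrite !mulr0 addr0 eqxx.
by rewrite finite_setU.
Qed.

(** The closure of [Cc] in the Sobolev norm, phrased by approximation instead of Cauchy sequences,
    which makes it easy to check under scaling, midpoints and perturbations. *)
Definition Cc_approx p u := forall e : R, 0 < e ->
  exists2 phi, Cc phi & (gint G (dens p (fun x => u x - phi x)%R) <= e%:E)%E.

Lemma Cc0 : Cc (cst 0 : V -> R).
Proof.
rewrite /Cc (_ : [set _ | _] = set0)//.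
by apply/seteqP; split=> // x /=; rewrite eqxx.
Qed.

Lemma Cc_approx0 p : 0 < p -> Cc_approx p (cst 0).
Proof.
move=> p0 e e0; exists (cst 0); first exact: Cc0.
have -> : (fun x => cst 0 x - cst 0 x) = cst 0 :> (V -> R).
  by apply/funext => x; rewrite subrr.
apply/gint_le_sumP => A.
by rewrite big1 ?ltW// => x _; rewrite dens0// mul0r.
Qed.

Lemma Cc_approx_scale p c u : Cc_approx p u -> Cc_approx p (fun x => c * u x).
Proof.
move=> au e e0; have c0 : 0 < `|c| `^ p + 1 by rewrite ltr_wpDl ?powR_ge0.
have [phi phic le] := au _ (divr_gt0 e0 c0).
exists (fun x => c * phi x).
  rewrite (_ : (fun x => _) = (fun x => c * phi x + 0 * phi x)); first exact: Cc_comb.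
  by apply/funext => x; rewrite mul0r addr0.
under eq_fun do rewrite -mulrBr.
apply: le_trans (gint_dens_scale c le) _.
by rewrite lee_fin mulrCA ler_piMr ?(ltW e0)// ler_pdivrMr// mul1r lerDl.
Qed.

Lemma Cc_approx_add p u psi : Cc psi -> Cc_approx p u ->
  Cc_approx p (fun x => u x + psi x).
Proof.
move=> psic au e e0; have [phi phic le] := au _ e0.
exists (fun x => 1 * phi x + 1 * psi x); first exact: Cc_comb.
rewrite (_ : (fun x => _) = (fun x => u x - phi x))//.
by apply/funext => x; ring.
Qed.

Lemma Cc_approx_midpoint p u v : 2 <= p -> Cc_approx p u -> Cc_approx p v ->
  Cc_approx p (fun x => (u x + v x) / 2).
Proof.
move=> p2 au av e e0; have [phi phic lep] := au _ e0.
have [psi psic leq] := av _ e0.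
exists (fun x => 2^-1 * phi x + 2^-1 * psi x); first exact: Cc_comb.
have := gint_dens_clarkson p2 lep leq.
rewrite (_ : (e + e) / 2 = e); last by field.
apply: le_trans; rewrite (_ : (fun x => _) =
  (fun y => ((u y - phi y) + (v y - psi y)) / 2)).
  by rewrite leeDl// gint_ge0//; exact: dens_ge0.
by apply/funext => x; field.
Qed.

(* The closed-convex-set argument usually done with Mazur's lemma: on small
   enough neighbourhoods of [u] the energy of almost minimal elements nearly
   equals the energy of their midpoints, so by Clarkson's inequality they are
   close to each other, and hence, by lower semicontinuity, to [u]. *)
Lemma Cc_approx_closure p (M : R) (S : set {ptws V -> R}) u : 2 <= p ->
  (forall w, S w -> Cc_approx p w /\ (gint G (dens p w) <= M%:E)%E) ->
  closure S u -> Cc_approx p u.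
Proof.
move=> p2 SM Su.
have p0 : 0 < p by lra.
pose S' : set {ptws V -> R} := [set w | Cc_approx p w /\ (gint G (dens p w) <= M%:E)%E].
have S'u : closure S' u by apply: closureS Su; exact: SM.
pose N w := fine (gint G (dens p w)).
have NE w : S' w -> (N w)%:E = gint G (dens p w).
  move=> [_ wM]; rewrite /N gint_fineK//; first exact: dens_ge0.
  by rewrite (le_lt_trans wM)// ltry.
have N0 w : 0 <= N w by rewrite fine_ge0// gint_ge0//; exact: dens_ge0.
(* [sup D] is the lower limit of the energy at [u] along [S']. *)
pose D : set R := [set r | exists2 U : set {ptws V -> R}, nbhs (u : {ptws V -> R}) U &
  forall w, S' w -> U w -> r <= N w].
have D0 : D 0 by exists setT => //; exact: filterT.
have DM : ubound D M.
  move=> r [U Uu rN]; have [w [S'w Uw]] := S'u _ Uu.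
  by rewrite (le_trans (rN _ S'w Uw))// -lee_fin NE//; case: S'w.
have Dsup : has_sup D by split; [exists 0|exists M].
move=> e e0.
(* The factor lost at the end: doubling (w - u)/2 turns 2 eta into 2^p 2 eta, and adding the error
   eta of the approximation of [w] costs the quasi-triangle constant. *)
pose C := 2 `^ p * ((2 `^ p * 2 + 1) / 2).
have pp : (0 : R) < 2 `^ p by rewrite powR_gt0.
have C0 : 0 < C by rewrite mulr_gt0// divr_gt0// addr_gt0// mulr_gt0.
pose eta := e / C; have eta0 : 0 < eta by rewrite divr_gt0.
have [r [U Uu rN] sr] := sup_adherent eta0 Dsup.
pose mid (z : {ptws V -> R} * {ptws V -> R}) : {ptws V -> R} :=
  fun x => (z.1 x + z.2 x) / 2.
have midx x : continuous (fun z : {ptws V -> R} * {ptws V -> R} => (z.1 x + z.2 x) / 2).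
  apply: continuous_midpoint => z.
    by apply: (@cvg_comp _ _ _ fst (fun w : {ptws V -> R} => w x) _ _ _ cvg_fst);
      exact: ptws_eval_continuous.
  by apply: (@cvg_comp _ _ _ snd (fun w : {ptws V -> R} => w x) _ _ _ cvg_snd);
    exact: ptws_eval_continuous.
have midc : continuous mid by exact: (@ptws_continuous R V _ mid midx).
have miduu : mid (u, u) = u by apply/funext => x; rewrite /mid/=; field.
(* Midpoints of points of [Q1] and [Q2] fall in [U], where the energy is at least r > sup D -
   eta. *)
have [[Q1 Q2] /= [Q1u Q2u] Q12] : nbhs ((u, u) : {ptws V -> R} * {ptws V -> R}) (mid @^-1` U).
  by apply: midc; rewrite miduu.
(* Otherwise sup D + eta would be a lower bound near [u], hence a member of [D]. *)
have near_u W : nbhs (u : {ptws V -> R}) W -> exists w, [/\ S' w, W w & N w <= sup D + eta].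
  move=> Wu; apply: contrapT => nex.
  suff : sup D + eta <= sup D by lra.
  apply: ub_le_sup; first by exists M.
  exists W => // w S'w Ww; apply: contrapT => /negP; rewrite -ltNge => /ltW Nw.
  by apply: nex; exists w.
have [w [S'w [Q1w Q2w] Nw]] := near_u (Q1 `&` Q2) (filterI Q1u Q2u).
pose S2 : set {ptws V -> R} := [set w' | [/\ S' w', Q2 w' & N w' <= sup D + eta]].
have S2u : closure S2 u.
  move=> B Bu; have [w' [? [? ?] ?]] := near_u (Q2 `&` B) (filterI Q2u Bu).
  by exists w'.
(* For fixed [w] and any w' in [S2], the two energies average to at most sup D + eta while the
   midpoint has more than sup D - eta, leaving at most 2 eta for (w - w')/2. Semicontinuity then
   replaces w' by [u]. *)
have half : (gint G (dens p (fun x => (w x - u x) / 2)%R) <= (2 * eta)%:E)%E.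
  pose K (w' : {ptws V -> R}) := dens p (fun x => (w x - w' x) / 2).
  apply: (@closure_gint_le _ _ _ _ S2 K u) => //.
    apply: (@dens_continuous p {ptws V -> R} (fun w' y => (w y - w' y) / 2)) => //.
    move=> x; apply: (@continuous_half_sub R _ (fun=> w x) (fun w' : {ptws V -> R} => w' x)).
      exact: cst_continuous.
    exact: ptws_eval_continuous.
  move=> w' [S'w' Q2w' Nw'].
  have hw : (gint G (dens p w) <= (sup D + eta)%:E)%E by rewrite -(NE w)// lee_fin.
  have hw' : (gint G (dens p w') <= (sup D + eta)%:E)%E by rewrite -(NE w')// lee_fin.
  have := gint_dens_clarkson p2 hw hw'.
  have S'm : S' (fun x => (w x + w' x) / 2).
    split; first by apply: Cc_approx_midpoint => //; [case: S'w|case: S'w'].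
    have := gint_dens_clarkson p2 (proj2 S'w) (proj2 S'w').
    rewrite (_ : (M + M) / 2 = M); last by field.
    by apply: le_trans; rewrite leeDl// gint_ge0//; exact: dens_ge0.
  have rm : r <= N (fun x => (w x + w' x) / 2) by apply: rN => //; exact: (Q12 (w, w')).
  rewrite -NE// /K; case: (gint G (dens p (fun x => (w x - w' x) / 2)%R)) => [t| |] //.
    by rewrite -EFinD !lee_fin => h; lra.
  by move=> _; exact: leNye.
have [phi phic le] := proj1 S'w _ eta0.
exists phi => //.
have uw := gint_dens_scale (-2) half.
have := gint_dens_add p2 uw le.
rewrite (_ : (fun x => _) = (fun x => u x - phi x)); last by apply/funext => x; field.
move=> h; apply: (le_trans h); rewrite lee_fin normrN (ger0_norm (ler0n R 2)).
rewrite (_ : _ * _ = C * eta) /C; last by field.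
by rewrite /eta mulrC divfK// gt_eqF.
Qed.

(** Approximations with error 1/(n+1) form a Cauchy sequence by the quasi-triangle inequality, and
    converge at each vertex because a single vertex has positive measure. *)
Lemma sobolev_of_Cc_approx p u : 2 <= p -> Cc_approx p u -> sobolev G p u.
Proof.
move=> p2 au; have p0 : 0 < p by lra.
have nV n : (0 : R) < n.+1%:R^-1 by rewrite invr_gt0.
pose phi n := sval (cid2 (au _ (nV n))).
have phiP n : Cc (phi n) /\ (gint G (dens p (fun x => u x - phi n x)%R) <= (n.+1%:R^-1)%:E)%E.
  by rewrite /phi; case: cid2.
exists phi; split=> [n|e e0|x]; first by case: (phiP n).
  (* The quasi-triangle bound is 2^p times the mean of two errors; errors below this value keep it
     below e^p. *)
  have e'0 : 0 < e `^ p / 2 `^ p by rewrite divr_gt0// powR_gt0.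
  have [N _ NP] := near_infty_natSinv_lt (PosNum e'0).
  exists N => m n Nm Nn.
  have hm := NP m Nm; have hn := NP n Nn; rewrite /= in hm hn.
  have neg := gint_dens_scale (-1) (proj2 (phiP m)).
  rewrite normrN1 powR1 mul1r in neg.
  have := gint_dens_add p2 (proj2 (phiP n)) neg.
  rewrite (_ : (fun x => _) = (fun x => phi m x - phi n x)); last first.
    by apply/funext => x; ring.
  set T := gint _ _ => TE; rewrite /sobolev_norm -/(dens p _) -/T.
  set r := _ * _ in TE.
  have r0 : 0 <= r by rewrite /r mulr_ge0 ?powR_ge0// divr_ge0// addr_ge0// ltW.
  have re : r < e `^ p.
    have half_lt (a b c : R) : a < c -> b < c -> (a + b) / 2 < c by move=> *; lra.
    by rewrite /r mulrC -ltr_pdivlMr ?powR_gt0//; exact: half_lt.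
  have T0 : (0 <= T)%E by rewrite gint_ge0//; exact: dens_ge0.
  apply: (@le_lt_trans _ _ (r `^ p^-1)%:E).
    rewrite -poweR_EFin; apply: gt0_ler_poweR => //.
    - by rewrite invr_ge0 ltW.
    - by rewrite in_itv/= T0 leey.
    - by rewrite in_itv/= lee_fin r0 leey.
  rewrite lte_fin (_ : e = (e `^ p) `^ p^-1).
    by apply: gt0_ltr_powR; rewrite ?invr_gt0 ?nnegrE ?powR_ge0.
  by rewrite -powRrM mulfV ?gt_eqF// powRr1// ltW.
apply/(@cvgrPdist_lt R R^o) => e e0.
have e'0 : 0 < e `^ p * mu G x by rewrite mulr_gt0 ?powR_gt0 ?mu_gt0.
have [N _ NP] := near_infty_natSinv_lt (PosNum e'0).
exists N => // n /= /NP /= hn; rewrite ltNge; apply/negP => en.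
have := mul_mu_le_gint x (@dens_ge0 p _) (proj2 (phiP n)).
apply/negP; rewrite -ltNge (lt_le_trans hn)// ler_wpM2r ?(ltW (mu_gt0 G x))//.
apply: ler_wpDl; first exact: powR_ge0.
by apply: ge0_ler_powR; rewrite ?nnegrE// ltW.
Qed.

End Density.

(** * Existence of minimisers *)

Section Minimizer.
Variables (R : realType) (V : choiceType) (G : wgraph R V).

Lemma compact_box (B : V -> R) :
  compact [set u : {ptws V -> R} | forall x, `[- B x, B x]%classic (u x)].
Proof.
by apply: (@tychonoff V (fun=> R) (fun x => `[- B x, B x]%classic)) => x;
  exact: segment_compact.
Qed.

(** A single term of the sum already bounds [u x]; these are the radii of the compact box. *)
Lemma norm_le_of_gint_dens p (u : V -> R) (M : R) x : 0 < p ->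
  (gint G (dens G p u) <= M%:E)%E -> `|u x| <= (M / mu G x) `^ p^-1.
Proof.
move=> p0 uM.
have h : `|u x| `^ p <= M / mu G x.
  rewrite ler_pdivlMr ?mu_gt0//.
  apply: le_trans (mul_mu_le_gint x (@dens_ge0 _ _ G p u) uM).
  by rewrite ler_wpM2r ?(ltW (mu_gt0 G x))// lerDr powR_ge0.
rewrite [leLHS](_ : _ = (`|u x| `^ p) `^ p^-1); last first.
  by rewrite -powRrM mulfV ?gt_eqF// powRr1.
have h0 := le_trans (powR_ge0 _ _) h.
by apply: ge0_ler_powR; rewrite ?nnegrE ?powR_ge0 ?invr_ge0 ?(ltW p0).
Qed.

(** The direct method for an abstract integrand that is continuous at each vertex and dominates the
    Sobolev densities. A cluster point of a minimising sequence replaces a convergent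
    subsequence. *)
Lemma exists_minimizer (p q c : R) (K : (V -> R) -> (V -> R) -> V -> R) :
  2 <= p -> 2 <= q -> 0 < c ->
  (forall x, continuous (fun z : {ptws V -> R} * {ptws V -> R} => K z.1 z.2 x)) ->
  (forall u v x, c * (dens G p u x + dens G q v x) <= K u v x) ->
  (gint G (K (cst 0%R) (cst 0%R)) < +oo)%E ->
  exists u v, [/\ Cc_approx G p u, Cc_approx G q v, (gint G (K u v) < +oo)%E &
    forall u' v', Cc_approx G p u' -> Cc_approx G q v' ->
      (gint G (K u v) <= gint G (K u' v'))%E].
Proof.
move=> p2 q2 c0 Kc Kge K00.
have p0 : 0 < p by lra.
have q0 : 0 < q by lra.
have K_ge0 u v x : 0 <= K u v x.
  apply: le_trans (Kge u v x).
  exact: (mulr_ge0 (ltW c0) (addr_ge0 (dens_ge0 _ _ _ _) (dens_ge0 _ _ _ _))).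
pose T : topologicalType := ({ptws V -> R} * {ptws V -> R})%type.
pose D : set (\bar R) := [set gint G (K z.1 z.2) | z in
  [set z : T | Cc_approx G p z.1 /\ Cc_approx G q z.2]].
have [m mE] : exists m : R, ereal_inf D = m%:E.
  exists (fine (ereal_inf D)); rewrite fineK// ge0_fin_numE.
    apply: le_lt_trans K00; apply: ge_ereal_inf.
    by exists (gint G (K (cst 0%R) (cst 0%R))); last exact: lexx;
      exists (cst 0, cst 0) => //=; split; exact: Cc_approx0.
  by apply: le_ereal_inf_tmp => _ [z _ <-]; exact: gint_ge0.
have ex n : exists z : T, [/\ Cc_approx G p z.1, Cc_approx G q z.2 &
    (gint G (K z.1 z.2) <= (m + n.+1%:R^-1)%:E)%E].
  have : (ereal_inf D < (m + n.+1%:R^-1)%:E)%E by rewrite mE lte_fin ltrDl invr_gt0.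
  by move=> /ereal_inf_lt [_ [z [zp zq] <-]] /ltW ?; exists z.
pose z n := sval (cid (ex n)).
have zP n : [/\ Cc_approx G p (z n).1, Cc_approx G q (z n).2 &
    (gint G (K (z n).1 (z n).2) <= (m + n.+1%:R^-1)%:E)%E].
  by rewrite /z; case: cid.
(* The energies exceed the infimum by 1/(n+1), hence by at most 1. *)
pose M := (m + 1) / c.
have zM n : (gint G (fun x => dens G p (z n).1 x + dens G q (z n).2 x)%R <= M%:E)%E.
  have [_ _ h] := zP n.
  apply: (@le_trans _ _ (gint G (fun x => c^-1 * K (z n).1 (z n).2 x)%R)).
    by apply: le_gint => x; rewrite mulrC ler_pdivlMr// mulrC.
  rewrite /M mulrC; apply: gint_scale_le; first by rewrite invr_ge0 ltW.
  apply: (le_trans h); rewrite lee_fin lerD2l invf_le1//.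
  by rewrite ler1n.
have zMp n : (gint G (dens G p (z n).1) <= M%:E)%E.
  by apply: le_trans (zM n); apply: le_gint => x; rewrite lerDl dens_ge0.
have zMq n : (gint G (dens G q (z n).2) <= M%:E)%E.
  by apply: le_trans (zM n); apply: le_gint => x; rewrite lerDr dens_ge0.
pose A r : set {ptws V -> R} :=
  [set u | forall x, `[- (M / mu G x) `^ r^-1, (M / mu G x) `^ r^-1]%classic (u x)].
have Ac r : compact (A r) by exact: compact_box.
have inbox n : (A p `*` A q) (z n).
  split => x /=; rewrite in_itv/= -ler_norml.
    exact: (norm_le_of_gint_dens x p0 (zMp n)).
  exact: (norm_le_of_gint_dens x q0 (zMq n)).
have boxc : compact (A p `*` A q) by apply: compact_setX.
have zA : (z @ \oo) (A p `*` A q) by exists 0%N => // n _; exact: inbox.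
have [w [_ wcl]] := boxc (z @ \oo) _ zA.
(* A cluster point lies in the closure of every tail, so semicontinuity on the N-th tail gives
   energy at most m + 1/(N+1). *)
have wtail N : closure [set z n | n in [set n | (N <= n)%N]] w.
  by move=> U Uw; apply: wcl => //; exists N => // n /= Nn; exists n.
have Kw N : (gint G (K w.1 w.2) <= (m + N.+1%:R^-1)%:E)%E.
  apply: (@closure_gint_le R V G T _ (fun z x => K z.1 z.2 x) w _ Kc (wtail N)) => _ [n /= Nn <-].
  have [_ _ h] := zP n; apply: (le_trans h).
  by rewrite lee_fin lerD2l lef_pV2 ?posrE// ler_nat.
have Kwm : (gint G (K w.1 w.2) <= m%:E)%E.
  apply/lee_addgt0Pr => e e0; have [N _ /(_ N (leqnn N)) /= h] := near_infty_natSinv_lt (PosNum e0).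
  by apply: (le_trans (Kw N)); rewrite -EFinD lee_fin lerD2l ltW.
exists w.1, w.2; split.
- apply: (@Cc_approx_closure _ _ _ _ M (range (fun n => (z n).1))) => //.
    by move=> _ [n _ <-]; split; [case: (zP n)|exact: zMp].
  move=> U Uw; have [_ [[n _ <-] Un]] := wtail 0%N (fst @^-1` U) (cvg_fst Uw).
  by exists (z n).1; split => //; exists n.
- apply: (@Cc_approx_closure _ _ _ _ M (range (fun n => (z n).2))) => //.
    by move=> _ [n _ <-]; split; [case: (zP n)|exact: zMq].
  move=> U Uw; have [_ [[n _ <-] Un]] := wtail 0%N (snd @^-1` U) (cvg_snd Uw).
  by exists (z n).2; split => //; exists n.
- by apply: (le_lt_trans Kwm); rewrite ltry.
- move=> u' v' au' av'; apply: (le_trans Kwm); rewrite -mE.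
  by apply: ereal_inf_lbound; exists (u', v').
Qed.

End Minimizer.

(** * Euler-Lagrange equations *)

Section Derivatives.
Variable R : realType.
Implicit Types (f g : R -> R) (a b c d r x : R).

Lemma is_derive_eq0_of_min f d : is_derive (0 : R) (1 : R) f d ->
  (forall t, f 0 <= f t) -> d = 0.
Proof.
move=> [df fd] fmin.
have cv : h^-1 * (f (h *: 1 + 0) - f 0) @[h --> 0^'] --> d.
  by rewrite -fd; exact: df.
have ge0 h : 0 <= f (h *: 1 + 0) - f 0 by rewrite subr_ge0.
have cvr := cvg_dnbhs_at_right cv.
have cvl := cvg_dnbhs_at_left cv.
apply/eqP; rewrite eq_le; apply/andP; split.
  apply: (@cvgr_to_le _ _ (at_left_proper_filter (0 : R)) _ _ _ _ cvl); near=> h.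
  by rewrite mulr_le0_ge0// invr_le0 ltW//; near: h; exact: nbhs_left_lt.
apply: (@cvgr_to_ge _ _ (at_right_proper_filter (0 : R)) _ _ _ _ cvr); near=> h.
by rewrite mulr_ge0// invr_ge0 ltW//; near: h; exact: nbhs_right_gt.
Unshelve. all: by end_near. Qed.

Lemma is_derive_add x f g a b : is_derive x (1 : R) f a ->
  is_derive x (1 : R) g b -> is_derive x (1 : R) (fun t => f t + g t) (a + b).
Proof. exact: is_deriveD. Qed.

Lemma is_derive_scale x f a c : is_derive x (1 : R) f a ->
  is_derive x (1 : R) (fun t => c * f t) (c * a).
Proof. exact: (@is_deriveZ R R R^o f c x 1 a). Qed.

Lemma is_derive_bigsum (I : Type) (s : seq I) (F : I -> R -> R) (dF : I -> R) x :
  (forall i, is_derive x (1 : R) (F i) (dF i)) ->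
  is_derive x (1 : R) (fun t => \sum_(i <- s) F i t) (\sum_(i <- s) dF i).
Proof.
move=> FdF; elim: s => [|i s IH].
  rewrite big_nil; under eq_fun do rewrite big_nil.
  exact: (@is_derive_cst R R R^o).
rewrite big_cons; under eq_fun do rewrite big_cons.
exact: is_derive_add.
Qed.

Lemma is_derive_quadratic a b c :
  is_derive (0 : R) (1 : R) (fun t : R => a + b * t + c * t ^+ 2) b.
Proof.
have h2 : is_derive (0 : R) (1 : R) (fun t : R => b * t) (b * 1).
  by apply: is_derive_scale; exact: is_derive_id.
have h3 : is_derive (0 : R) (1 : R) (fun t : R => c * t ^+ 2) (c * 0).
  apply: is_derive_scale.
  have := @is_deriveX R R^o id 2 0 1 1 (is_derive_id _ _).
  by rewrite /= expr1 mulr0 scale0r.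
have h1 := @is_derive_cst R R R^o a 0 1.
have := is_derive_add (is_derive_add h1 h2) h3.
by rewrite mulr1 mulr0 add0r addr0.
Qed.

(** The difference quotient at the origin has absolute value |h|^(r-1), which tends to 0. *)
Lemma is_derive_norm_powR0 r : 1 < r ->
  is_derive (0 : R) (1 : R) (fun t : R => `|t| `^ r) 0.
Proof.
move=> r1; pose g (t : R) := `|t| `^ r; rewrite -/g.
have r20 : 0 < r - 1 by lra.
have r2 : 0 < r by lra.
have gq (h : R) : h != 0 ->
    `|h^-1 * (g (h * 1 + 0) - g 0)| = `| `|h| `^ (r - 1) |.
  move=> h0; rewrite /g addr0 mulr1 normr0 powR0 ?gt_eqF// subr0.
  rewrite -(mulr_powRB1 (normr_ge0 h) r2) !normrM normr_id normrV ?unitfE//.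
  by rewrite mulKf ?normr_eq0.
have cv : h^-1 * (g (h * 1 + 0) - g 0) @[h --> 0^'] --> (0 : R).
  have cn : `|h| `^ (r - 1) @[h --> (0 : R)] --> (0 : R).
    rewrite [X in _ --> X](_ : _ = `|0 : R| `^ (r - 1)).
      exact: (continuous_norm_powR r20).
    by rewrite normr0 powR0// gt_eqF.
  have cn' : `|h| `^ (r - 1) @[h --> (0 : R)^'] --> (0 : R).
    by apply: cvg_trans cn; apply: cvg_app; exact: cvg_within.
  apply/(@cvgr0Pnorm_lt R R^o) => e e0; near=> h.
  rewrite gq; last by near: h; exact: nbhs_dnbhs_neq.
  near: h; exact: (@cvgr0_norm_lt R R^o _ _ _ _ cn').
apply: DeriveDef; first by apply/cvg_ex; exists 0.
exact: cvg_lim.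
Unshelve. all: by end_near. Qed.

(* At a zero of the quadratic the base of the power vanishes to second order,
   and the value of the formula is [0] also for [r = 1] since then [b = 0]. *)
Lemma is_derive_quadratic_powR a b c r : 1 <= r ->
  (forall t, 0 <= a + b * t + c * t ^+ 2) ->
  is_derive (0 : R) (1 : R) (fun t => (a + b * t + c * t ^+ 2) `^ r)
    (r * a `^ (r - 1) * b).
Proof.
move=> r1 q0.
have a0 : 0 <= a by have := q0 0; rewrite mulr0 expr0n mulr0 !addr0.
have [a_gt0|a_le0] := ltP 0 a.
  pose q t := a + b * t + c * t ^+ 2.
  have q00 : q 0 = a by rewrite /q mulr0 expr0n mulr0 !addr0.
  have dq := is_derive_quadratic a b c.
  have := @is_derive1_powR R r (q 0); rewrite q00 => /(_ a_gt0) dp.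
  have := @is_derive1_comp R (fun y => y `^ r) q 0.
  move=> /(_ (r * a `^ (r - 1)) b); rewrite q00; exact.
have {a_le0} a_eq0 : a = 0 by apply/eqP; rewrite eq_le a_le0.
(* A nonnegative quadratic vanishing at 0 has its minimum there. *)
have b0 : b = 0.
  apply: (is_derive_eq0_of_min (is_derive_quadratic a b c)) => t.
  by rewrite mulr0 expr0n mulr0 !addr0 [leLHS]a_eq0 q0.
have c0 : 0 <= c by have := q0 1; rewrite a_eq0 b0 mul0r expr1n mulr1 !add0r.
rewrite a_eq0 b0 mulr0.
have fE : (fun t => (0 + 0 * t + c * t ^+ 2) `^ r) = fun t => c `^ r * `|t| `^ (r * 2).
  apply/funext => t; rewrite mul0r !add0r powRM ?sqr_ge0//; congr (_ * _).
  by rewrite -sqr_powR; congr powR; field.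
have r21 : 1 < r * 2 by lra.
by have := is_derive_scale (c `^ r) (is_derive_norm_powR0 r21); rewrite fE mulr0.
Qed.

End Derivatives.

Section EulerLagrange.
Variables (R : realType) (V : choiceType) (G : wgraph R V).
Implicit Types (u v h : V -> R) (x y z : V) (p t : R).

Definition dirac_at z : V -> R := fun x => (x == z)%:R.

Lemma Cc_dirac_at z t : Cc (fun x => t * dirac_at z x).
Proof.
apply: (@sub_finite_set _ _ [set z]); last exact: finite_set1.
by move=> x /=; rewrite /dirac_at; have [->//|_] := eqVneq x z; rewrite mulr0 eqxx.
Qed.

Lemma Gamma_perturb u v x t :
  Gamma G (fun y => u y + t * v y) (fun y => u y + t * v y) x =
  Gamma G u u x + (2 * Gamma G u v x) * t + Gamma G v v x * t ^+ 2.
Proof.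
rewrite !GammaE; set m := _^-1.
rewrite (_ : 2 * (m * _) * t = m * (\sum_(y <- nbr G x)
  2 * (weight G x y * (u y - u x) * (v y - v x)) * t)); last first.
  by rewrite -mulr_suml -mulr_sumr; ring.
rewrite (_ : m * _ * t ^+ 2 = m * (\sum_(y <- nbr G x)
  weight G x y * (v y - v x) * (v y - v x) * t ^+ 2)); last first.
  by rewrite -mulr_suml; ring.
rewrite -!mulrDr -!big_split /=; congr (_ * _).
by apply: eq_bigr => y _; ring.
Qed.

(** Along a line the p-th power of the gradient is a nonnegative quadratic raised to p/2, with
    linear coefficient [2 * Gamma G u v x]; the factors 2, p/2 and 1/p cancel. Zeros of the gradient
    need no exception. *)
Lemma is_derive_grad_powR p u v x : 2 <= p ->
  is_derive (0 : R) (1 : R) (fun t => p^-1 * grad G (fun y => u y + t * v y) x `^ p)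
    (grad G u x `^ (p - 2) * Gamma G u v x).
Proof.
move=> p2.
under eq_fun do rewrite grad_powR Gamma_perturb.
have p21 : 1 <= p / 2 by lra.
have q0 t : 0 <= Gamma G u u x + (2 * Gamma G u v x) * t + Gamma G v v x * t ^+ 2.
  by rewrite -Gamma_perturb Gamma_ge0.
have := is_derive_scale p^-1 (is_derive_quadratic_powR p21 q0).
rewrite grad_powR (_ : p / 2 - 1 = (p - 2) / 2); last by field.
set X := Gamma G u u x `^ _.
rewrite (_ : p^-1 * _ = X * Gamma G u v x)//.
by field; lra.
Qed.

Lemma is_derive_norm_powR p (a b : R) : 2 <= p ->
  is_derive (0 : R) (1 : R) (fun t => p^-1 * `|a + t * b| `^ p)
    (`|a| `^ (p - 2) * a * b).
Proof.
move=> p2.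
have p21 : 1 <= p / 2 by lra.
have sqE t : (a + t * b) ^+ 2 = a ^+ 2 + (2 * a * b) * t + b ^+ 2 * t ^+ 2 by ring.
have q0 t : 0 <= a ^+ 2 + (2 * a * b) * t + b ^+ 2 * t ^+ 2 by rewrite -sqE sqr_ge0.
under eq_fun do rewrite -sqr_powR sqE.
have := is_derive_scale p^-1 (is_derive_quadratic_powR p21 q0).
rewrite (_ : p / 2 - 1 = (p - 2) / 2); last by field.
rewrite sqr_powR; set X := `|a| `^ _.
rewrite (_ : p^-1 * _ = X * a * b)//.
by field; lra.
Qed.

Lemma sum_dirac_at (s : {fset V}) (f : V -> R) z :
  \sum_(y <- s) f y * dirac_at z y = if z \in s then f z else 0.
Proof.
case: ifP => zs.
  rewrite (bigD1_seq z zs (fset_uniq s)) /=.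
  rewrite /dirac_at eqxx mulr1 big1 ?addr0// => y /negPf ->.
  by rewrite mulr0.
rewrite big_seq big1// => y ys; rewrite /dirac_at; case: eqP => [yz|_].
  by rewrite -yz ys in zs.
by rewrite mulr0.
Qed.

(** In the sum over neighbours of [x], the indicator at [z] leaves the term of [z] if it is
    adjacent, and the whole sum if [x] is [z]. *)
Lemma mu_Gamma_dirac_at u z x : mu G x * Gamma G u (dirac_at z) x =
  2^-1 * ((if adj G x z then weight G x z * (u z - u x) else 0) -
    dirac_at z x * \sum_(y <- nbr G x) weight G x y * (u y - u x)).
Proof.
rewrite GammaE invfM mulrCA mulrA -!mulrA; congr (_ * _).
rewrite mulKf ?gt_eqF ?mu_gt0//.
under eq_bigr do rewrite mulrBr.
rewrite sumrB sum_dirac_at in_nbr; congr (_ - _).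
by rewrite -mulr_suml mulrC.
Qed.

(** Green's formula tested with an indicator. The neighbours of [z] contribute the part of the
    p-Laplacian weighted by the gradient at [y], the vertex [z] the part weighted by its own
    gradient; symmetry of the weights makes them combine. *)
Lemma sum_mu_Gamma_dirac_at p u z (A : {fset V}) : z \in A ->
  (forall x, adj G z x -> x \in A) ->
  \sum_(x <- A) mu G x * (grad G u x `^ (p - 2) * Gamma G u (dirac_at z) x) =
  - (mu G z * pLaplacian G p u z).
Proof.
move=> zA nA.
have sub : (nbr G z `<=` A)%fset by apply/fsubsetP => x; rewrite in_nbr; exact: nA.
under eq_bigr do rewrite mulrCA mu_Gamma_dirac_at mulrCA mulrBr.
rewrite -mulr_sumr sumrB.
under [X in _ * (_ - X)]eq_bigr do rewrite mulrCA mulrC.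
rewrite sum_dirac_at zA.
rewrite [X in _ * (X - _)](_ : _ = \sum_(x <- nbr G z)
   grad G u x `^ (p - 2) * (weight G z x * (u z - u x))); last first.
  rewrite -(big_fset_incl _ sub) => [|x xA]; last first.
    by rewrite in_nbr adj_sym => /negPf ->; rewrite mulr0.
  rewrite [LHS]big_seq [RHS]big_seq; apply: eq_bigr => x; rewrite in_nbr => zx.
  by rewrite adj_sym zx -(weight_sym zx).
rewrite /pLaplacian fsbig_finite; last exact: locally_finite.
rewrite -/(nbr G z) mulr_sumr -sumrB invfM mulrCA -!mulrA mulKf ?gt_eqF ?mu_gt0//.
rewrite -mulrN -sumrN; congr (_ * _).
by apply: eq_bigr => y _; ring.
Qed.

Definition potential_energy p h (Psi : V -> R -> R) u x :=
  p^-1 * grad G u x `^ p + h x * (p^-1 * `|u x| `^ p) + Psi x (u x).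

Lemma gint_fsetID f (A : {fset V}) : (forall x, 0 <= f x) ->
  gint G f = ((\sum_(x <- A) f x * mu G x)%:E +
              \esum_(x in (~` [set` A])) (f x * mu G x)%:E)%E.
Proof.
move=> f0; have f0' x : (0 <= (f x * mu G x)%:E)%E.
  by rewrite lee_fin mulr_ge0// ltW// mu_gt0.
rewrite /gint (esumID [set` A])//; congr (_ + _)%E; last by congr esum; rewrite setTI.
rewrite setTI esum_fset//.
by rewrite fsbig_finite//= set_fsetK sumEFin.
Qed.

Lemma euler_lagrange p h Psi u z d : 2 <= p ->
  (forall w x, 0 <= potential_energy p h Psi w x) ->
  (gint G (potential_energy p h Psi u) < +oo)%E ->
  (forall t, (gint G (potential_energy p h Psi u) <=
    gint G (potential_energy p h Psi (fun x => u x + t * dirac_at z x)%R))%E) ->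
  is_derive (0 : R) (1 : R) (fun t => Psi z (u z + t)) d ->
  - pLaplacian G p u z + h z * `|u z| `^ (p - 2) * u z + d = 0.
Proof.
move=> p2 E0 Eoo Emin Psid.
pose ut t x := u x + t * dirac_at z x.
pose A : {fset V} := (z |` nbr G z)%fset.
have zA : z \in A by rewrite !inE eqxx.
have nA x : adj G z x -> x \in A by rewrite !inE in_nbr => ->; rewrite orbT.
pose phi t := \sum_(x <- A) potential_energy p h Psi (ut t) x * mu G x.
have u0 : ut 0 = u by apply/funext => x; rewrite /ut mul0r addr0.
have off t x : x \notin A -> potential_energy p h Psi (ut t) x = potential_energy p h Psi u x.
  rewrite !inE negb_or in_nbr => /andP[xz nzx].
  have utx : ut t x = u x by rewrite /ut /dirac_at (negPf xz) mulr0 addr0.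
  rewrite /potential_energy utx /grad !GammaE utx.
  congr (_ * Num.sqrt (_ * _) `^ _ + _ + _).
  rewrite [LHS]big_seq [RHS]big_seq; apply: eq_bigr => y; rewrite in_nbr => xy.
  have -> // : ut t y = u y.
  rewrite /ut /dirac_at; case: eqP => [yz|_]; last by rewrite mulr0 addr0.
  by rewrite yz adj_sym (negPf nzx) in xy.
have phimin t : phi 0 <= phi t.
  have := Emin t; rewrite -/(ut t) => Et.
  have F0 := gint_fsetID A (E0 u); have Ft := gint_fsetID A (E0 (ut t)).
  rewrite /phi u0 -lee_fin.
  have rest : \esum_(x in (~` [set` A])) (potential_energy p h Psi (ut t) x * mu G x)%:E =
      \esum_(x in (~` [set` A])) (potential_energy p h Psi u x * mu G x)%:E.
    by apply: eq_esum => x /= /negP xA; rewrite off.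
  move: Et Eoo; rewrite Ft F0 rest.
  (* The tail outside [A] is common to both energies and finite because the energy of [u] is, so it
     cancels. *)
  set r := esum _ _.
  have : (0 <= r)%E.
    by apply: esum_ge0 => x _; rewrite lee_fin mulr_ge0// ltW// mu_gt0.
  case: r => [r| |] //= _; rewrite -?EFinD ?lee_fin// => + _.
  by rewrite lerD2r.
have dphi : is_derive (0 : R) (1 : R) phi (mu G z * (- pLaplacian G p u z +
    h z * `|u z| `^ (p - 2) * u z + d)).
  have Dx x : is_derive (0 : R) (1 : R) (fun t => potential_energy p h Psi (ut t) x * mu G x)
     (mu G x * (grad G u x `^ (p - 2) * Gamma G u (dirac_at z) x) +
      (mu G x * (h x * (`|u x| `^ (p - 2) * u x) + d)) * dirac_at z x).
    under eq_fun do rewrite mulrC.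
    rewrite -mulrA -mulrDr; apply: is_derive_scale.
    rewrite mulrDl addrA; apply: is_derive_add.
      apply: is_derive_add; first exact: is_derive_grad_powR.
      rewrite -mulrA; apply: is_derive_scale; exact: is_derive_norm_powR.
    rewrite /ut /dirac_at; case: eqP => [->|_]; last first.
      under eq_fun do rewrite mulr0; rewrite mulr0.
      exact: (@is_derive_cst R R R^o).
    by under eq_fun do rewrite mulr1; rewrite mulr1.
  have := is_derive_bigsum (enum_fset A) Dx.
  rewrite big_split /= sum_mu_Gamma_dirac_at// sum_dirac_at zA.
  by rewrite -mulrN -mulrDr addrA mulrA.
have /eqP := is_derive_eq0_of_min dphi phimin.
by rewrite mulf_eq0 gt_eqF ?mu_gt0//= => /eqP.
Qed.

End EulerLagrange.

(** * A priori bounds *)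

(** Young's inequality for x and y divided by a^(1/p) and b^(1/q). If a and b are the integrals of
    x^p and y^q, the bracket integrates to 1, which is Hölder's inequality. *)
Lemma young_normalized (R : realType) (a b x y p q : R) : 0 < a -> 0 < b ->
  0 <= x -> 0 <= y -> 0 < p -> 0 < q -> p^-1 + q^-1 = 1 ->
  x * y <= a `^ p^-1 * b `^ q^-1 * ((a * p)^-1 * x `^ p + (b * q)^-1 * y `^ q).
Proof.
move=> a0 b0 x0 y0 p0 q0 pq.
have root (c r : R) : 0 < c -> 0 < r -> exists n, [/\ 0 < n, c = n `^ r & c `^ r^-1 = n].
  move=> c0 r0; exists (c `^ r^-1); split => //; first exact: powR_gt0.
  by rewrite -powRrM mulVf ?powRr1 ?(ltW c0)// gt_eqF.
have [n [n0 aE ->]] := root a p a0 p0.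
have [m [m0 bE ->]] := root b q b0 q0.
have le := conjugate_powR (divr_ge0 x0 (ltW n0)) (divr_ge0 y0 (ltW m0)) p0 q0 pq.
have xE : x `^ p = (x / n) `^ p * a.
  by rewrite aE -powRM ?divr_ge0 ?(ltW n0)// divfK// gt_eqF.
have yE : y `^ q = (y / m) `^ q * b.
  by rewrite bE -powRM ?divr_ge0 ?(ltW m0)// divfK// gt_eqF.
rewrite xE yE; move: le; set X := _ `^ p; set Y := _ `^ q => le.
rewrite (_ : x * y = n * m * (x / n * (y / m))); last by field; rewrite !gt_eqF.
apply: ler_wpM2l; first by rewrite mulr_ge0 ?(ltW n0) ?(ltW m0).
apply: (le_trans le); rewrite le_eqVlt; apply/orP; left; apply/eqP.
by field; rewrite !gt_eqF.
Qed.

Section APriori.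
Variables (R : realType) (V : choiceType) (G : wgraph R V).
Implicit Types (u f g e h : V -> R) (x : V) (p t : R).

Lemma gint_le0_eq0 f x : (forall y, 0 <= f y) -> (gint G f <= 0)%E -> f x = 0.
Proof.
move=> f0 /(mul_mu_le_gint x f0) fx; apply/eqP; rewrite eq_le f0 andbT.
by rewrite -(pmulr_lle0 _ (mu_gt0 G x)).
Qed.

Lemma gint_holder p f g : 1 < p -> (forall x, 0 <= f x) -> (forall x, 0 <= g x) ->
  (gint G (fun x => f x `^ (p / (p - 1)))%R < +oo)%E ->
  (gint G (fun x => g x `^ p)%R < +oo)%E ->
  (gint G (fun x => f x * g x)%R <=
   (fine (gint G (fun x => f x `^ (p / (p - 1)))%R) `^ (p / (p - 1))^-1 *
    fine (gint G (fun x => g x `^ p)%R) `^ p^-1)%:E)%E.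
Proof.
move=> p1 f0 g0; set p' := p / (p - 1) => foo goo.
have p0 : 0 < p by lra.
have p10 : 0 < p - 1 by lra.
have p'0 : 0 < p' by rewrite divr_gt0.
have pp' : p'^-1 + p^-1 = 1.
  by rewrite /p'; field; rewrite !gt_eqF.
have fE := gint_fineK (fun x => powR_ge0 (f x) p') foo.
have gE := gint_fineK (fun x => powR_ge0 (g x) p) goo.
set a := fine _ in fE *; set b := fine _ in gE *; clearbody a b.
(* The normalisation divides by both integrals; if one vanishes, so does the corresponding
   function. *)
have zero (w1 w2 : V -> R) r (c : R) : (forall x, 0 <= w1 x) -> 0 < r -> 0 <= c ->
    (gint G (fun x => w1 x `^ r)%R <= 0)%E -> (gint G (fun x => w1 x * w2 x)%R <= c%:E)%E.
  move=> w0 r0 c0 w; apply/gint_le_sumP => A; rewrite big1// => x _.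
  have /eqP := gint_le0_eq0 x (fun y => powR_ge0 (w1 y) r) w.
  by rewrite powR_eq0 => /andP[/eqP -> _]; rewrite !mul0r.
have ab0 : 0 <= a `^ p'^-1 * b `^ p^-1 by rewrite mulr_ge0 ?powR_ge0.
have [a_le0|a0] := leP a 0.
  by apply: (zero f g p') => //; rewrite -fE lee_fin.
have [b_le0|b0] := leP b 0.
  rewrite (eq_gint G (g := fun x => g x * f x)); last by move=> x; rewrite mulrC.
  by apply: (zero g f p) => //; rewrite -gE lee_fin.
have na0 : 0 < a `^ p'^-1 by exact: powR_gt0.
have nb0 : 0 < b `^ p^-1 by exact: powR_gt0.
have young x := young_normalized a0 b0 (f0 x) (g0 x) p'0 p0 pp'.
move: young na0 nb0; set na := a `^ _; set nb := b `^ _ => young na0 nb0.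
clearbody na nb.
apply: (le_trans (le_gint G young)).
rewrite [X in (_ <= X%:E)%E](_ : _ = na * nb * ((a * p')^-1 * a + (b * p)^-1 * b)); last first.
  rewrite -[LHS]mulr1; congr (_ * _); rewrite -pp'.
  by field; rewrite !gt_eqF.
apply: gint_scale_le; first by rewrite mulr_ge0// ltW.
rewrite gintD; last 2 first.
- by move=> x; rewrite mulr_ge0 ?powR_ge0// invr_ge0 mulr_ge0// ltW.
- by move=> x; rewrite mulr_ge0 ?powR_ge0// invr_ge0 mulr_ge0// ltW.
rewrite EFinD leeD//; apply: gint_scale_le.
- by rewrite invr_ge0 mulr_ge0// ltW.
- by rewrite fE.
- by rewrite invr_ge0 mulr_ge0// ltW.
- by rewrite gE.
Qed.

(** Convexity of the p-th power: its tangent at t lies below it at 1. Obtained from Young's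
    inequality for the product of t^(p-1) and 1. *)
Lemma powR_bernoulli p t : 1 < p -> 0 <= t ->
  t `^ p + p * (1 - t) * t `^ (p - 1) <= 1.
Proof.
move=> p1 t0; have p0 : 0 < p by lra.
have p10 : 0 < p - 1 by lra.
have p'0 : 0 < p / (p - 1) by rewrite divr_gt0.
have pp' : (p / (p - 1))^-1 + p^-1 = 1 by field; rewrite !gt_eqF.
have := conjugate_powR (powR_ge0 t (p - 1)) ler01 p'0 p0 pp'.
rewrite -powRrM [(p - 1) * _]mulrC divfK ?gt_eqF// powR1 mulr1.
set s := t `^ (p - 1); have <- : t * s = t `^ p by exact: mulr_powRB1.
move=> le; have : s * p <= (t * s / (p / (p - 1)) + 1 / p) * p by rewrite ler_pM2r.
rewrite (_ : (_ + _) * p = t * s * (p - 1) + 1); first lra.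
by field; rewrite !gt_eqF.
Qed.

Lemma le_of_powR_scale (S M r : R) : 0 < r -> 0 <= M ->
  (forall t, 0 < t -> t < 1 -> t `^ r * S <= M) -> S <= M.
Proof.
move=> r0 M0 H; rewrite leNgt; apply/negP => MS.
have S0 : 0 < S by apply: le_lt_trans MS.
(* A number strictly between M/S and 1; its r-th root is a scale t violating the hypothesis. *)
pose s := (M / S + 1) / 2.
have MS1 : M / S < 1 by rewrite ltr_pdivrMr// mul1r.
have MS0 : 0 <= M / S by rewrite divr_ge0// ltW.
have s0 : 0 < s by rewrite /s; lra.
have s1 : s < 1 by rewrite /s; lra.
have sr1 : s `^ r^-1 < 1.
  have one : 1 `^ r^-1 = 1 :> R by rewrite powR1.
  have ri0 : 0 < r^-1 by rewrite invr_gt0.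
  by rewrite -[ltRHS]one; apply: (gt0_ltr_powR ri0); rewrite ?nnegrE ?ler01// ltW.
have := H (s `^ r^-1) (powR_gt0 _ s0) sr1.
rewrite -powRrM mulVf ?gt_eqF// powRr1 ?(ltW s0)//.
rewrite (_ : s * S = (M + S) / 2); first lra.
by rewrite /s; field; rewrite gt_eqF.
Qed.

(** Plays the role of testing the equation with [u] itself, which need not be finitely supported.
    Shrinking [u] to [t u] lowers the homogeneous part by at least (1-t) t^(p-1) times its integrand
    and raises [Psi] by at most (1-t) H; minimality allows division by 1-t. *)
Lemma gint_energy_le p h Psi u (H : V -> R) (M : R) : 2 <= p ->
  (forall x, 0 <= h x) ->
  (forall w x, 0 <= potential_energy G p h Psi w x) ->
  (gint G (potential_energy G p h Psi u) < +oo)%E ->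
  (forall t, (gint G (potential_energy G p h Psi u) <=
    gint G (potential_energy G p h Psi (fun x => t * u x)%R))%E) ->
  (forall x, 0 <= H x) -> (gint G H <= M%:E)%E ->
  (forall t x, 0 < t -> t < 1 -> Psi x (t * u x) <= Psi x (u x) + (1 - t) * H x) ->
  (gint G (fun x => grad G u x `^ p + h x * `|u x| `^ p)%R <= M%:E)%E.
Proof.
move=> p2 h0 E0 Eoo Emin H0 HM Psit.
have p1 : 1 < p by lra.
have p0 : 0 < p by lra.
have M0 : 0 <= M by rewrite -lee_fin (le_trans _ HM)// gint_ge0.
pose P x := grad G u x `^ p + h x * `|u x| `^ p.
have P0 x : 0 <= P x by rewrite addr_ge0 ?mulr_ge0 ?powR_ge0.
(* Bernoulli's inequality leaves the factor t^(p-1), removed by letting t tend to 1 on each finite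
   sum. *)
apply/gint_le_sumP => A; apply: (@le_of_powR_scale _ _ (p - 1)) => //; first lra.
move=> t t0 t1; have t10 : 0 < 1 - t by lra.
rewrite mulr_sumr; under eq_bigr do rewrite mulrA.
move: A; apply/gint_le_sumP.
have gradt x : grad G (fun y => t * u y) x `^ p = t `^ p * grad G u x `^ p.
  rewrite !grad_powR Gamma_scale (powRM _ (sqr_ge0 t) (Gamma_ge0 _ _ _)).
  by rewrite sqr_powR gtr0_norm.
have pw x : potential_energy G p h Psi (fun y => t * u y) x +
    (1 - t) * (t `^ (p - 1) * P x) <= potential_energy G p h Psi u x + (1 - t) * H x.
  rewrite /potential_energy gradt normrM (powRM _ (normr_ge0 t) (normr_ge0 _)) gtr0_norm//.
  have := Psit t x t0 t1; have := powR_bernoulli p1 (ltW t0).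
  move=> bern Pt.
  have bP : (p^-1 * t `^ p + (1 - t) * t `^ (p - 1)) * P x <= p^-1 * P x.
    apply: ler_wpM2r => //; rewrite -(ler_pM2l p0) mulrDr mulVKf ?gt_eqF//.
    by rewrite mulfV ?gt_eqF// !mulrA.
  rewrite /P in bP *.
  set X := grad G u x `^ p in bP *; set Y := `|u x| `^ p in bP *.
  set T := t `^ p in bP *; set T' := t `^ (p - 1) in bP *.
  set i := p^-1 in bP *.
  have -> : i * (T * X) + h x * (i * (T * Y)) + Psi x (t * u x) + (1 - t) * (T' * (X + h x * Y))
    = (i * T + (1 - t) * T') * (X + h x * Y) + Psi x (t * u x) by ring.
  have -> : i * X + h x * (i * Y) + Psi x (u x) + (1 - t) * H x =
    i * (X + h x * Y) + (Psi x (u x) + (1 - t) * H x) by ring.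
  exact: lerD.
have tP0 x : 0 <= (1 - t) * (t `^ (p - 1) * P x).
  by rewrite !mulr_ge0 ?powR_ge0// ltW.
have HM' := gint_scale_le (ltW t10) HM.
have tP : (gint G (fun x => (1 - t) * (t `^ (p - 1) * P x))%R <= ((1 - t) * M)%:E)%E.
  have tH0 x : 0 <= (1 - t) * H x by exact: mulr_ge0 (ltW t10) (H0 x).
  have := le_gint G pw; rewrite (gintD G (E0 _) tP0) (gintD G (E0 _) tH0) => le1.
  have le2 := le_trans (leeD (Emin t) (lexx _)) le1.
  have Efin : gint G (potential_energy G p h Psi u) \is a fin_num.
    by rewrite ge0_fin_numE// gint_ge0.
  by move: le2; rewrite leeD2lE// => /le_trans; exact.
have i0 : 0 <= (1 - t)^-1 by rewrite invr_ge0 ltW.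
have := gint_scale_le i0 tP; rewrite mulKf ?gt_eqF//.
apply: le_trans; apply: le_gint => x.
by rewrite mulKf ?gt_eqF// lexx.
Qed.

(** With n = U^(1/p) the hypothesis reads (h0 - A) n^p <= C n; dividing by n bounds the L^p norm,
    and the lower bound on the measure turns it into a bound at each vertex. *)
Lemma supnorm_le_of_energy p (mu0 h0 A C : R) u : 1 < p -> 0 < mu0 ->
  (forall x, mu0 <= mu G x) -> A < h0 -> 0 <= C ->
  (gint G (fun x => `|u x| `^ p)%R < +oo)%E ->
  (let U := fine (gint G (fun x => `|u x| `^ p)%R) in
    h0 * U <= A * U + C * U `^ p^-1) ->
  (supnorm u <= (mu0 `^ (- p^-1) * (C / (h0 - A)) `^ (p - 1)^-1)%:E)%E.
Proof.
move=> p1 mu00 muge Ah C0 Uoo; set U := fine _ => /= UC.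
have p0 : 0 < p by lra.
have p10 : 0 < p - 1 by lra.
have k0 : 0 < h0 - A by lra.
have UE := gint_fineK (fun x => powR_ge0 `|u x| p) Uoo; rewrite -/U in UE.
clearbody U.
have U0 : 0 <= U by rewrite -lee_fin UE gint_ge0// => x; exact: powR_ge0.
have nU : U `^ p^-1 <= (C / (h0 - A)) `^ (p - 1)^-1.
  have [->|Un0] := eqVneq U 0; first by rewrite powR0 ?powR_ge0 ?invr_eq0 ?gt_eqF.
  have {}Un0 : 0 < U by rewrite lt_neqAle eq_sym Un0.
  set n := U `^ p^-1 in UC *; have n0 : 0 < n by rewrite powR_gt0.
  have nE : n `^ p = U by rewrite /n -powRrM mulVf ?gt_eqF// powRr1.
  have le : n `^ (p - 1) <= C / (h0 - A).
    rewrite ler_pdivlMr// -(ler_pM2l n0) mulrA mulr_powRB1 ?(ltW n0)// nE; lra.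
  have -> : n = (n `^ (p - 1)) `^ (p - 1)^-1.
    by rewrite -powRrM mulfV ?gt_eqF// powRr1// ltW.
  apply: ge0_ler_powR => //; rewrite ?nnegrE ?powR_ge0 ?invr_ge0 ?(ltW p10)//.
  by rewrite divr_ge0// ltW.
apply: ge_ereal_sup => _ [x _ <-]; rewrite lee_fin.
have upM : `|u x| `^ p <= U / mu0.
  rewrite ler_pdivlMr//.
  apply: (@le_trans _ _ (`|u x| `^ p * mu G x)); first by rewrite ler_wpM2l ?powR_ge0.
  by apply: (mul_mu_le_gint x (f := fun x => `|u x| `^ p));
    [move=> y; exact: powR_ge0|rewrite UE].
rewrite (_ : `|u x| = (`|u x| `^ p) `^ p^-1); last first.
  by rewrite -powRrM mulfV ?gt_eqF// powRr1.
apply: (@le_trans _ _ ((U / mu0) `^ p^-1)).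
  have pi0 : 0 <= p^-1 by rewrite invr_ge0 ltW.
  apply: (ge0_ler_powR pi0) => //; rewrite nnegrE ?powR_ge0//.
  by rewrite divr_ge0// ltW.
rewrite powRM ?invr_ge0 ?(ltW mu00)// mulrC -[mu0^-1]powR_inv1 ?(ltW mu00)//.
by rewrite -powRrM mulN1r ler_wpM2l ?powR_ge0.
Qed.

Lemma LnormV_lty r f : r != 0 -> inL G r f -> (gint G (fun x => `|f x| `^ r)%R < +oo)%E.
Proof. by move=> r0; apply: lty_poweRy; rewrite invr_eq0. Qed.

Lemma fine_LnormV r f : fine (LnormV G r f) = fine (gint G (fun x => `|f x| `^ r)%R) `^ r^-1.
Proof. exact: fine_poweR. Qed.

(** Hölder's inequality bounds the integral of the increment of [Psi] by A U + C U^(1/p), while h >=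
    h0 bounds the homogeneous part below by h0 U. *)
Lemma supnorm_minimizer_le p (mu0 h0 A l : R) h e g Psi u : 2 <= p -> 0 < mu0 ->
  (forall x, mu0 <= mu G x) -> 0 <= A -> A < h0 -> (forall x, h0 <= h x) -> 0 < l ->
  (forall x, 0 <= g x) -> inL G (p / (p - 1)) e -> inL G (p / (p - 1)) g ->
  (gint G (fun x => `|u x| `^ p)%R < +oo)%E ->
  (forall w x, 0 <= potential_energy G p h Psi w x) ->
  (gint G (potential_energy G p h Psi u) < +oo)%E ->
  (forall t, (gint G (potential_energy G p h Psi u) <=
    gint G (potential_energy G p h Psi (fun x => t * u x)%R))%E) ->
  (forall t x, 0 < t -> t < 1 -> Psi x (t * u x) <= Psi x (u x) +
    (1 - t) * (A * `|u x| `^ p + (l * (`|e x| * `|u x|) + g x * `|u x|))) ->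
  (supnorm u <= (mu0 `^ (- p^-1) *
    ((l * fine (LnormV G (p / (p - 1)) e) + fine (LnormV G (p / (p - 1)) g))
      / (h0 - A)) `^ (p - 1)^-1)%:E)%E.
Proof.
move=> p2 mu00 muge A0 Ah hge l0 g0 eL gL uoo E0 Eoo Emin Psit.
have p1 : 1 < p by lra.
have p0 : 0 < p by lra.
have p10 : 0 < p - 1 by lra.
have p'0 : p / (p - 1) != 0 by rewrite gt_eqF// divr_gt0.
rewrite !fine_LnormV.
set C := l * _ + _.
have C0 : 0 <= C by rewrite addr_ge0 ?mulr_ge0 ?powR_ge0// ltW.
apply: supnorm_le_of_energy => //.
set U := fine _ => /=.
have UE := gint_fineK (fun x => powR_ge0 `|u x| p) uoo; rewrite -/U in UE.
clearbody U.
have Ule : (gint G (fun x => `|u x| `^ p)%R <= U%:E)%E by rewrite UE.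
have gE : (fun x => `|g x| `^ (p / (p - 1))) = (fun x => g x `^ (p / (p - 1))).
  by apply/funext => x; rewrite ger0_norm.
have holdE := gint_holder p1 (fun x => normr_ge0 (e x)) (fun x => normr_ge0 (u x))
  (LnormV_lty p'0 eL) uoo.
have goo := LnormV_lty p'0 gL; rewrite gE in goo.
have holdG := gint_holder p1 g0 (fun x => normr_ge0 (u x)) goo uoo.
rewrite -UE /= in holdE holdG.
have HM : (gint G (fun x => A * `|u x| `^ p + (l * (`|e x| * `|u x|) + g x * `|u x|))%R
    <= (A * U + C * U `^ p^-1)%:E)%E.
  rewrite gintD; last 2 first.
  - by move=> x; rewrite mulr_ge0 ?powR_ge0.
  - by move=> x; rewrite addr_ge0 ?mulr_ge0// ltW.
  rewrite gintD; last 2 first.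
  - by move=> x; rewrite !mulr_ge0// ltW.
  - by move=> x; rewrite mulr_ge0.
  rewrite EFinD; apply: leeD; first exact: gint_scale_le.
  rewrite /C gE mulrDl EFinD; apply: leeD => //.
  by rewrite -mulrA; exact: (gint_scale_le (ltW l0) holdE).
have h_ge0 x : 0 <= h x by have := hge x; lra.
have H0 x : 0 <= A * `|u x| `^ p + (l * (`|e x| * `|u x|) + g x * `|u x|).
  exact: (addr_ge0 (mulr_ge0 A0 (powR_ge0 _ _)) (addr_ge0 (mulr_ge0 (ltW l0)
    (mulr_ge0 (normr_ge0 _) (normr_ge0 _))) (mulr_ge0 (g0 x) (normr_ge0 _)))).
have := gint_energy_le p2 h_ge0 E0 Eoo Emin H0 HM Psit.
have h0u : (gint G (fun x => h0 * `|u x| `^ p)%R <=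
    gint G (fun x => grad G u x `^ p + h x * `|u x| `^ p)%R)%E.
  apply: le_gint => x; apply: ler_wpDl; first exact: powR_ge0.
  by rewrite ler_wpM2r ?powR_ge0.
move=> /(le_trans h0u) le.
have h00 : 0 < h0 by lra.
have hi : 0 <= h0^-1 by rewrite invr_ge0 ltW.
have := gint_scale_le hi le.
rewrite (eq_gint G (g := fun x => `|u x| `^ p)); last by move=> x; rewrite mulKf ?gt_eqF.
by rewrite -UE lee_fin mulrC ler_pdivlMr// mulrC.
Qed.

End APriori.

(** * The nonlinearity *)

Section Primitive.
Variable R : realType.
Implicit Types (f df : R -> R) (a b s t p : R).

Lemma is_derive_translate f a d :
  is_derive (0 : R) (1 : R) (fun t => f (a + t)) d -> is_derive a (1 : R) f d.
Proof.
move=> fd.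
have sh : is_derive a (1 : R) (fun t : R => t + - a) (1 + 0).
  by apply: is_derive_add.
have := @is_derive1_comp R (fun t => f (a + t)) (fun t => t + - a) a d (1 + 0).
rewrite subrr => /(_ fd sh); rewrite addr0 mulr1 (_ : _ \o _ = f)//.
by apply/funext => t /=; congr f; ring.
Qed.

Lemma mvt_everywhere f df a b : (forall s, is_derive s (1 : R) f (df s)) -> a <= b ->
  exists2 c, a <= c <= b & f b - f a = df c * (b - a).
Proof.
move=> fd ab.
have fc : {within `[a, b], continuous f}.
  by apply: derivable_within_continuous => x _; case: (fd x).
have [c cab E] := MVT_segment ab (fun x _ => fd x) fc.
by exists c => //; move: cab; rewrite in_itv.
Qed.

(** The mean value theorem applied to the primitive of the majorant minus [f], whose derivative is
    nonnegative; no integral of [df] is formed. *)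
Lemma le_primitive_powR_nneg f df (A D : R) p s : 2 <= p ->
  (forall s, is_derive s (1 : R) f (df s)) ->
  (forall s, 0 <= s -> df s <= A * s `^ (p - 1) + D) -> 0 <= s ->
  f s - f 0 <= A / p * s `^ p + D * s.
Proof.
move=> p2 fd dfle s0.
have pd x : is_derive x (1 : R) (fun t => p^-1 * `|t| `^ p) (`|x| `^ (p - 2) * x).
  apply: is_derive_translate.
  have := is_derive_norm_powR x 1 p2; rewrite mulr1.
  by under eq_fun do rewrite mulr1.
pose g t := A * (p^-1 * `|t| `^ p) + (D * t + (-1) * f t).
have gd x : is_derive x (1 : R) g (A * (`|x| `^ (p - 2) * x) + (D * 1 + (-1) * df x)).
  by apply: is_derive_add.
have [c /andP[c0 _]] := mvt_everywhere gd s0.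
rewrite subr0 => E.
have : 0 <= g s - g 0.
  rewrite E mulr_ge0//.
  have := dfle c c0; have p10 : 0 < p - 1 by lra.
  rewrite -(mulr_powRB1 c0 p10) (_ : p - 1 - 1 = p - 2); last by ring.
  rewrite (ger0_norm c0) [c * _]mulrC; lra.
have p0 : 0 < p by lra.
rewrite /g normr0 powR0 ?gt_eqF//.
rewrite !mulr0 add0r (ger0_norm s0) => le.
have -> : A / p * s `^ p = A * (p^-1 * s `^ p) by ring.
by lra.
Qed.

Lemma norm_primitive_le f df (A D : R) p s : 2 <= p ->
  (forall s, is_derive s (1 : R) f (df s)) ->
  (forall s, `|df s| <= A * `|s| `^ (p - 1) + D) ->
  `|f s - f 0| <= A / p * `|s| `^ p + D * `|s|.
Proof.
move=> p2 fd dfle.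
(* One-sided bounds for f and -f give the absolute value; composing with the reflection of the line
   handles negative arguments. *)
have key f1 df1 s1 : (forall s, is_derive s (1 : R) f1 (df1 s)) ->
    (forall s, `|df1 s| <= A * `|s| `^ (p - 1) + D) -> 0 <= s1 ->
    `|f1 s1 - f1 0| <= A / p * s1 `^ p + D * s1.
  move=> fd1 dfle1 s10; rewrite ler_norml; apply/andP; split; last first.
    apply: (le_primitive_powR_nneg p2 fd1) => // r r0.
    by have := dfle1 r; rewrite (ger0_norm r0); apply: le_trans; exact: ler_norm.
  have fd2 r : is_derive r (1 : R) (fun t => (-1) * f1 t) ((-1) * df1 r).
    exact: is_derive_scale.
  have := @le_primitive_powR_nneg (fun t => (-1) * f1 t) _ A D p s1 p2 fd2 _ s10.
  rewrite !mulN1r => H; rewrite lerNl opprB addrC -[X in _ + X]opprK.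
  rewrite [X in X <= _](_ : _ = - f1 s1 - - f1 0); last by ring.
  apply: H => r r0; have := dfle1 r; rewrite (ger0_norm r0); apply: le_trans.
  by rewrite -normrN mulN1r ler_norm.
have [s0|s0] := leP 0 s; first by rewrite (ger0_norm s0); exact: (key _ _ _ fd dfle s0).
rewrite (ltr0_norm s0).
have fdN r : is_derive r (1 : R) (f \o -%R) (df (- r) * -1).
  exact: (is_derive1_comp (fd (- r)) (is_deriveNid r 1)).
have := key (f \o -%R) (fun r => df (- r) * -1) (- s) fdN.
rewrite /= opprK oppr0; apply; last by rewrite oppr_ge0 ltW.
by move=> r; rewrite mulrN1 normrN -[X in _ * X `^ _]normrN.
Qed.

(** Mean value theorem along the ray from t s to s: the intermediate point is no larger than s in
    absolute value, so the growth bound at s applies. *)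
Lemma primitive_scale_le f df (A D : R) p s t : 1 < p -> 0 <= A -> 0 <= D ->
  (forall s, is_derive s (1 : R) f (df s)) ->
  (forall s, `|df s| <= A * `|s| `^ (p - 1) + D) -> 0 < t -> t < 1 ->
  f s - f (t * s) <= (1 - t) * (A * `|s| `^ p + D * `|s|).
Proof.
move=> p1 A0 D0 fd dfle t0 t1.
have fds r : is_derive r (1 : R) (fun r => f (s * r)) (df (s * r) * (s * 1)).
  have sd : is_derive r (1 : R) (fun r : R => s * r) (s * 1).
    by apply: is_derive_scale; exact: is_derive_id.
  exact: (is_derive1_comp (fd (s * r)) sd).
have [c /andP[tc c1] E] := mvt_everywhere fds (ltW t1).
rewrite mulr1 in E; rewrite [t * s]mulrC E mulrC.
apply: ler_wpM2l; first by rewrite subr_ge0 ltW.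
apply: (le_trans (ler_norm _)); rewrite normrM.
have p0 : 0 < p by lra.
rewrite -(mulr_powRB1 (normr_ge0 s) p0).
rewrite [leRHS](_ : _ = (A * `|s| `^ (p - 1) + D) * `|s|); last by ring.
apply: ler_wpM2r => //; apply: (le_trans (dfle _)); rewrite lerD2r.
apply: ler_wpM2l => //.
have p10 : 0 <= p - 1 by lra.
apply: (ge0_ler_powR p10); rewrite ?nnegrE// normrM ler_piMr//.
by rewrite ger0_norm//; lra.
Qed.

(** Adding K|s|^b gives a function with minimum at 0, and the added term has derivative 0 there
    since b > 1. Thus (F2) kills a partial derivative of F at the origin. *)
Lemma is_derive_eq0_of_powR_lower f d (K b : R) : 1 < b ->
  is_derive (0 : R) (1 : R) f d -> f 0 = 0 ->
  (forall s, - K * `|s| `^ b <= f s) -> d = 0.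
Proof.
move=> b1 fd f0 Kf.
have pd := is_derive_scale K (is_derive_norm_powR0 b1).
have := is_derive_eq0_of_min (is_derive_add fd pd).
rewrite mulr0 addr0; apply => t.
rewrite f0 normr0 powR0; last by rewrite gt_eqF; lra.
by rewrite mulr0 add0r; have := Kf t; lra.
Qed.

(** The gap (h0 - theta)/r is divided in two: one half survives as a multiple of h, the other pays
    for two Young terms of a quarter each. Equality holds at h = h0, and the right side has the
    larger slope in h. *)
Lemma coercive_coef (h0 h theta r : R) : 0 < h0 -> h0 <= h -> 0 <= theta -> theta < h0 ->
  0 < r -> (h0 - theta) / r / (2 * h0) * h + 2 * ((h0 - theta) / r / 4) <=
    r^-1 * h - theta / r.
Proof.
move=> h00 h0h th0 thh r0.
have ri : 0 < r^-1 by rewrite invr_gt0.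
have -> : (h0 - theta) / r / (2 * h0) * h + 2 * ((h0 - theta) / r / 4) =
   r^-1 * ((h0 - theta) / 2 * (h / h0) + (h0 - theta) / 2).
  by field; rewrite !gt_eqF.
have -> : r^-1 * h - theta / r = r^-1 * (h0 * (h / h0) - theta).
  by field; rewrite !gt_eqF.
apply: ler_wpM2l; first exact: ltW.
have : 1 <= h / h0 by rewrite ler_pdivlMr// mul1r.
set y := h / h0 => y1.
have : 0 <= (h0 + theta) / 2 * (y - 1) by rewrite mulr_ge0//; lra.
rewrite mulrBr mulr1; have -> : (h0 + theta) / 2 * y = h0 * y - (h0 - theta) / 2 * y by field.
lra.
Qed.

End Primitive.

Section Nonlinearity.
Variables (R : realType) (V : Type) (F : V -> R -> R -> R).
Hypothesis F_C1 : C1_in_st F.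

Lemma is_derive_Fs x s t : is_derive s (1 : R) (fun s' => F x s' t) (Fs F x s t).
Proof.
have [dF _ _] := F_C1 x.
have d1 : differentiable (fun s' : R => (s', t) : R * R) s.
  by apply: differentiable_pair; [exact: ex_diff|exact: differentiable_cst].
have := @differentiable_comp R _ _ _ _ (fun z : R * R => F x z.1 z.2) s d1 (dF (s, t)).
move=> /derivable1_diffP D; apply: DeriveDef; first exact: D.
by rewrite /Fs derive1E.
Qed.

Lemma is_derive_Ft x s t : is_derive t (1 : R) (fun t' => F x s t') (Ft F x s t).
Proof.
have [dF _ _] := F_C1 x.
have d1 : differentiable (fun t' : R => (s, t') : R * R) t.
  by apply: differentiable_pair; [exact: differentiable_cst|exact: ex_diff].
have := @differentiable_comp R _ _ _ _ (fun z : R * R => F x z.1 z.2) t d1 (dF (s, t)).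
move=> /derivable1_diffP D; apply: DeriveDef; first exact: D.
by rewrite /Ft derive1E.
Qed.

Lemma continuous_F (T : topologicalType) (f g : T -> R) x :
  continuous f -> continuous g -> continuous (fun w => F x (f w) (g w)).
Proof.
move=> fc gc w.
have [dF _ _] := F_C1 x.
have Fc : {for (f w, g w), continuous (fun z : R * R => F x z.1 z.2)}.
  exact: differentiable_continuous.
exact: (@continuous_comp _ _ _ (fun w => (f w, g w)) (fun z : R * R => F x z.1 z.2) w
  (cvg_pair (fc w) (gc w)) Fc).
Qed.

End Nonlinearity.

(** * Growth of F and the integrable shift *)

Section Energy.
Variables (R : realType) (V : choiceType) (G : wgraph R V).
Variables (p q h0 A1 A2 l1 l2 : R) (h1 h2 e1 e2 g1 g2 : V -> R).
Variable F : V -> R -> R -> R.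
Hypotheses (p2 : 2 <= p) (q2 : 2 <= q) (h00 : 0 < h0).
Hypotheses (h1_ge : forall x, h0 <= h1 x) (h2_ge : forall x, h0 <= h2 x).
Hypotheses (A1_ge0 : 0 <= A1) (A1_lt : 2 * A1 < h0) (A2_ge0 : 0 <= A2).
Hypothesis (A2_lt : q * (p - 1) / p * A1 + A2 < h0).
Hypotheses (l10 : 0 < l1) (l20 : 0 < l2).
Hypotheses (g10 : forall x, 0 <= g1 x) (g20 : forall x, 0 <= g2 x).
Hypotheses (e1_L : inL G (p / (p - 1)) e1) (e2_L : inL G (q / (q - 1)) e2).
Hypotheses (g1_L : inL G (p / (p - 1)) g1) (g2_L : inL G (q / (q - 1)) g2).
Hypotheses (F_C1 : C1_in_st F) (F_00 : forall x, F x 0 0 = 0).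
Hypothesis Fs_growth : forall x s t, `|Fs F x s t| <=
  A1 * (`|s| `^ (p - 1) + `|t| `^ ((p * q - q) / p)) + g1 x.
Hypothesis Ft_growth : forall x t, `|Ft F x 0 t| <= A2 * `|t| `^ (q - 1) + g2 x.

Let p0 : 0 < p. Proof. by have := p2; lra. Qed.
Let q0 : 0 < q. Proof. by have := q2; lra. Qed.

(** F is integrated from the origin along the axis s = 0, where the |s|^p term of the growth of F_t
    vanishes, and then in s at fixed t. The mixed term |s| |t|^((pq-q)/p) is split with exponents p
    and p/(p-1), which turn it into |s|^p and |t|^q. *)
Lemma norm_F_le x s t : `|F x s t| <= 2 * A1 / p * `|s| `^ p +
  (q * (p - 1) / p * A1 + A2) / q * `|t| `^ q + (g1 x * `|s| + g2 x * `|t|).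
Proof.
have p10 : 0 < p - 1 by have := p2; lra.
have Fs_le s' : `|Fs F x s' t| <= A1 * `|s'| `^ (p - 1) +
    (A1 * `|t| `^ ((p * q - q) / p) + g1 x).
  by apply: (le_trans (Fs_growth x s' t)); rewrite mulrDr addrA.
have b1 := norm_primitive_le s p2 (fun s => is_derive_Fs F_C1 x s t) Fs_le.
have b2 := norm_primitive_le t q2 (is_derive_Ft F_C1 x 0) (Ft_growth x).
rewrite F_00 subr0 in b2.
have p'0 : 0 < p / (p - 1) by rewrite divr_gt0.
have pp' : p^-1 + (p / (p - 1))^-1 = 1 by field; rewrite !gt_eqF.
have := conjugate_powR (normr_ge0 s) (powR_ge0 `|t| ((p * q - q) / p)) p0 p'0 pp'.
rewrite -powRrM (_ : (p * q - q) / p * (p / (p - 1)) = q); last first.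
  by field; rewrite !gt_eqF.
set W := `|t| `^ ((p * q - q) / p) in b1 *.
move=> /(ler_wpM2l A1_ge0) young.
have tri : `|F x s t| <= `|F x s t - F x 0 t| + `|F x 0 t|.
  by rewrite -[X in `|X| <= _](subrK (F x 0 t)) ler_normD.
apply: (le_trans tri); apply: (le_trans (lerD b1 b2)).
rewrite (_ : 2 * A1 / p * `|s| `^ p + _ + _ =
  A1 / p * `|s| `^ p + (A1 * (`|s| `^ p / p + `|t| `^ q / (p / (p - 1))) + g1 x * `|s|)
  + (A2 / q * `|t| `^ q + g2 x * `|t|)); last by field; rewrite !gt_eqF.
by rewrite !lerD// mulrDl lerD// -mulrA [W * _]mulrC.
Qed.

(** The linear terms in g_i and e_i are split by Young's inequality into small multiples of |s|^p
    and |t|^q, paid for by [coercive_coef], and conjugate powers of g_i and e_i, which form the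
    integrable [B]. *)
Lemma exists_energy_shift : exists (c : R) (B : V -> R),
  [/\ 0 < c, forall x, 0 <= B x, (gint G B < +oo)%E & forall x s t,
    c * (h1 x * `|s| `^ p) + c * (h2 x * `|t| `^ q) <=
    h1 x * (p^-1 * `|s| `^ p) + h2 x * (q^-1 * `|t| `^ q) -
    F x s t - l1 * (e1 x * s) - l2 * (e2 x * t) + B x].
Proof.
have p1 : 1 < p by have := p2; lra.
have q1 : 1 < q by have := q2; lra.
pose th := q * (p - 1) / p * A1 + A2.
have th_lt : th < h0 := A2_lt.
have th0 : 0 <= th.
  by rewrite addr_ge0// mulr_ge0// divr_ge0 ?(ltW p0)// mulr_ge0 ?(ltW q0)// subr_ge0 ltW.
pose d1 := (h0 - 2 * A1) / p; pose d2 := (h0 - th) / q.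
have d10 : 0 < d1 by rewrite divr_gt0// subr_gt0.
have d20 : 0 < d2 by rewrite divr_gt0// subr_gt0.
have k10 : 0 < d1 / 4 by rewrite divr_gt0.
have k20 : 0 < d2 / 4 by rewrite divr_gt0.
have [C1 C10 Y1] := young_scaled p1 k10.
(* Division by [l1] anticipates the multiplication of this inequality by [l1]. *)
have [C2 C20 Y2] := young_scaled p1 (divr_gt0 k10 l10).
have [C3 C30 Y3] := young_scaled q1 k20.
have [C4 C40 Y4] := young_scaled q1 (divr_gt0 k20 l20).
pose B1 x := C1 * `|g1 x| `^ (p / (p - 1)); pose B2 x := l1 * C2 * `|e1 x| `^ (p / (p - 1)).
pose B3 x := C3 * `|g2 x| `^ (q / (q - 1)); pose B4 x := l2 * C4 * `|e2 x| `^ (q / (q - 1)).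
have l1C : 0 <= l1 * C2 by rewrite mulr_ge0// ltW.
have l2C : 0 <= l2 * C4 by rewrite mulr_ge0// ltW.
have B10 x : 0 <= B1 x by rewrite mulr_ge0 ?powR_ge0.
have B20 x : 0 <= B2 x by rewrite mulr_ge0 ?powR_ge0.
have B30 x : 0 <= B3 x by rewrite mulr_ge0 ?powR_ge0.
have B40 x : 0 <= B4 x by rewrite mulr_ge0 ?powR_ge0.
have B120 x : 0 <= B1 x + B2 x by rewrite addr_ge0.
have B340 x : 0 <= B3 x + B4 x by rewrite addr_ge0.
have p'0 : p / (p - 1) != 0 by rewrite gt_eqF// divr_gt0// subr_gt0.
have q'0 : q / (q - 1) != 0 by rewrite gt_eqF// divr_gt0// subr_gt0.
pose c := Num.min (d1 / (2 * h0)) (d2 / (2 * h0)).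
have h20 : 0 < 2 * h0 by rewrite mulr_gt0.
have c0 : 0 < c by rewrite lt_min (divr_gt0 d10 h20) (divr_gt0 d20 h20).
exists c, (fun x => B1 x + B2 x + (B3 x + B4 x)); split => //.
- by move=> x; rewrite addr_ge0.
- apply: gint_lty_add => //; apply: gint_lty_add => //;
    apply: gint_lty_scale => //; try (by move=> x; exact: powR_ge0);
    exact: LnormV_lty.
move=> x s t.
have cc1 := coercive_coef h00 (h1_ge x) (mulr_ge0 (ler0n R 2) A1_ge0) A1_lt p0.
have cc2 := coercive_coef h00 (h2_ge x) th0 th_lt q0.
rewrite -/d1 in cc1; rewrite -/d2 in cc2.
have FB := le_trans (ler_norm _) (norm_F_le x s t); rewrite -/th in FB.
have y1 := Y1 _ _ (normr_ge0 (g1 x)) (normr_ge0 s).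
have y2 := ler_wpM2l (ltW l10) (Y2 _ _ (normr_ge0 (e1 x)) (normr_ge0 s)).
have y3 := Y3 _ _ (normr_ge0 (g2 x)) (normr_ge0 t).
have y4 := ler_wpM2l (ltW l20) (Y4 _ _ (normr_ge0 (e2 x)) (normr_ge0 t)).
rewrite -normrM in y2; rewrite -normrM in y4.
have z2 : l1 * (e1 x * s) <= l1 * `|e1 x * s| by rewrite ler_pM2l// ler_norm.
have z4 : l2 * (e2 x * t) <= l2 * `|e2 x * t| by rewrite ler_pM2l// ler_norm.
rewrite mulrDr [l1 * (_ / _ * _)]mulrA [l1 * (_ / _)]mulrC divfK ?gt_eqF// in y2.
rewrite mulrDr [l2 * (_ / _ * _)]mulrA [l2 * (_ / _)]mulrC divfK ?gt_eqF// in y4.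
rewrite [l1 * (C2 * _)]mulrA -/(B2 x) in y2; rewrite [l2 * (C4 * _)]mulrA -/(B4 x) in y4.
rewrite -/(B1 x) in y1; rewrite -/(B3 x) in y3.
rewrite -(ger0_norm (g10 x)) -(ger0_norm (g20 x)) in FB.
have X0 := powR_ge0 `|s| p; have T0 := powR_ge0 `|t| q.
set X := `|s| `^ p in X0 y1 y2 FB *; set T := `|t| `^ q in T0 y3 y4 FB *.
have w1 : c * h1 x * X + (d1 / 4 * X + d1 / 4 * X) <=
    p^-1 * h1 x * X - 2 * A1 / p * X.
  rewrite [leLHS](_ : _ = (c * h1 x + 2 * (d1 / 4)) * X); last by ring.
  rewrite [leRHS](_ : _ = (p^-1 * h1 x - 2 * A1 / p) * X); last by ring.
  apply: ler_wpM2r => //; apply: le_trans cc1; rewrite lerD2r.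
  by apply: ler_wpM2r; [exact: le_trans (ltW h00) (h1_ge x)|rewrite /c ge_min lexx].
have w2 : c * h2 x * T + (d2 / 4 * T + d2 / 4 * T) <=
    q^-1 * h2 x * T - th / q * T.
  rewrite [leLHS](_ : _ = (c * h2 x + 2 * (d2 / 4)) * T); last by ring.
  rewrite [leRHS](_ : _ = (q^-1 * h2 x - th / q) * T); last by ring.
  apply: ler_wpM2r => //; apply: le_trans cc2; rewrite lerD2r.
  by apply: ler_wpM2r; [exact: le_trans (ltW h00) (h2_ge x)|rewrite /c ge_min lexx orbT].
clearbody c d1 d2 th X T.
move: (B1 x) (B2 x) (B3 x) (B4 x) y1 y2 y3 y4 => b1 b2 b3 b4 y1 y2 y3 y4.
have -> : h1 x * (p^-1 * X) = p^-1 * h1 x * X by ring.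
have -> : h2 x * (q^-1 * T) = q^-1 * h2 x * T by ring.
have -> : c * (h1 x * X) = c * h1 x * X by ring.
have -> : c * (h2 x * T) = c * h2 x * T by ring.
move: (p^-1 * h1 x * X) (q^-1 * h2 x * T) (c * h1 x * X) (c * h2 x * T)
  (d1 / 4 * X) (d2 / 4 * T) (2 * A1 / p * X) (th / q * T)
  (`|g1 x| * `|s|) (`|g2 x| * `|t|) (l1 * `|e1 x * s|) (l2 * `|e2 x * t|)
  (l1 * (e1 x * s)) (l2 * (e2 x * t)) (F x s t) w1 w2 y1 y2 y3 y4 z2 z4 FB.
move=> *; lra.
Qed.

End Energy.

(** * The coupled system *)

Lemma is_derive_translate0 (R : realType) (f : R -> R) (a d : R) :
  is_derive a (1 : R) f d -> is_derive (0 : R) (1 : R) (fun t => f (a + t)) d.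
Proof.
move=> fd; apply: is_derive_translate.
rewrite -[a]addr0 in fd.
have sh : is_derive (0 : R) (1 : R) (fun t : R => a + t) (0 + 1) by apply: is_derive_add.
have := is_derive1_comp fd sh; rewrite add0r mulr1.
by rewrite (_ : _ \o _ = (fun t => f (a + (0 + t))))//; apply/funext => t; rewrite /= add0r.
Qed.

Section ContinuousArith.
Variables (R : realType) (T : topologicalType).
Implicit Types f g : T -> R.

Lemma continuous_add f g : continuous f -> continuous g -> continuous (fun w => f w + g w).
Proof. by move=> fc gc w; apply: (@cvgD R R^o); [exact: fc|exact: gc]. Qed.

Lemma continuous_scale (c : R) f : continuous f -> continuous (fun w => c * f w).
Proof. by move=> fc w; apply: cvgM; [exact: cvg_cst|exact: fc]. Qed.

End ContinuousArith.

(** The vertex [x0] excludes the value [-oo] of the supremum norm, and the strict bound excludes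
    [+oo]. *)
Lemma supnormP (R : realType) (V : choiceType) (f : V -> R) (M : R) (x0 : V) :
  (forall x, 0 <= f x) -> (supnorm f < M%:E)%E ->
  exists A, [/\ supnorm f = A%:E, 0 <= A, A < M & forall x, f x <= A].
Proof.
move=> f0 fM.
have ub x : ((f x)%:E <= supnorm f)%E.
  by apply: ereal_sup_ubound; exists x => //; rewrite ger0_norm.
have := ub x0; move: fM ub; case: (supnorm f) => [A| |] //= fM ub fx0.
exists A; split => //.
by apply: (@le_trans _ _ (f x0)); rewrite // -lee_fin.
Qed.

Section Coupled.
Variables (R : realType) (V : choiceType) (G : wgraph R V).
Variables (p q l1 l2 : R) (h1 h2 e1 e2 B : V -> R) (F : V -> R -> R -> R).

(* The whole integrand of the system, read as the energy of one component with
   the other one frozen. *)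
Definition coupling1 v x s := q^-1 * grad G v x `^ q + h2 x * (q^-1 * `|v x| `^ q) +
  (- F x s (v x) - l1 * (e1 x * s) - l2 * (e2 x * v x) + B x).

Definition coupling2 u x t := p^-1 * grad G u x `^ p + h1 x * (p^-1 * `|u x| `^ p) +
  (- F x (u x) t - l1 * (e1 x * u x) - l2 * (e2 x * t) + B x).

Definition energy u v := potential_energy G p h1 (coupling1 v) u.

(** Lets every scalar result proved for the first component serve the second one. *)
Lemma energyE u v : energy u v = potential_energy G q h2 (coupling2 u) v.
Proof.
by apply/funext => x; rewrite /energy /potential_energy /coupling1 /coupling2 addrA
  [RHS]addrA; congr (_ + _); rewrite addrC.
Qed.

Lemma energy_continuous (T : topologicalType) (phi psi : T -> V -> R) :
  0 < p -> 0 < q -> C1_in_st F ->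
  (forall x, continuous (fun w => phi w x)) ->
  (forall x, continuous (fun w => psi w x)) ->
  forall x, continuous (fun w => energy (phi w) (psi w) x).
Proof.
move=> p0 q0 F_C1 phic psic x; rewrite /energy /potential_energy /coupling1.
have cc (r : R) : continuous (fun _ : T => r) by exact: cst_continuous.
have opp (f : T -> R) : continuous f -> continuous (fun w => - f w).
  by move=> fc w; apply: (@cvgN R R^o); exact: fc.
apply: continuous_add; first apply: continuous_add.
- by apply: continuous_scale; exact: grad_powR_continuous.
- by do 2 apply: continuous_scale; exact: norm_powR_continuous.
apply: continuous_add; first apply: continuous_add.
- by apply: continuous_scale; exact: grad_powR_continuous.
- by do 2 apply: continuous_scale; exact: norm_powR_continuous.
apply: continuous_add; last exact: cc.
apply: continuous_add; first apply: continuous_add.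
- by apply: opp; exact: continuous_F.
- by apply: opp; do 2 apply: continuous_scale; exact: phic.
- by apply: opp; do 2 apply: continuous_scale; exact: psic.
Qed.

Lemma is_derive_coupling1 v x s : C1_in_st F ->
  is_derive s (1 : R) (coupling1 v x) (- Fs F x s (v x) - l1 * e1 x).
Proof.
move=> F_C1.
rewrite (_ : coupling1 v x = fun s => (-1) * F x s (v x) + (- (l1 * e1 x) * s +
  (q^-1 * grad G v x `^ q + h2 x * (q^-1 * `|v x| `^ q) - l2 * (e2 x * v x) + B x))).
  have d1 := is_derive_Fs F_C1 x s (v x).
  rewrite (_ : - Fs F x s (v x) - l1 * e1 x =
    (-1) * Fs F x s (v x) + (- (l1 * e1 x) * 1 + 0)); last by ring.
  by apply: is_derive_add.
by apply/funext => s'; rewrite /coupling1; ring.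
Qed.

Lemma is_derive_coupling2 u x t : C1_in_st F ->
  is_derive t (1 : R) (coupling2 u x) (- Ft F x (u x) t - l2 * e2 x).
Proof.
move=> F_C1.
rewrite (_ : coupling2 u x = fun t => (-1) * F x (u x) t + (- (l2 * e2 x) * t +
  (p^-1 * grad G u x `^ p + h1 x * (p^-1 * `|u x| `^ p) - l1 * (e1 x * u x) + B x))).
  have d1 := is_derive_Ft F_C1 x (u x) t.
  rewrite (_ : - Ft F x (u x) t - l2 * e2 x =
    (-1) * Ft F x (u x) t + (- (l2 * e2 x) * 1 + 0)); last by ring.
  by apply: is_derive_add.
by apply/funext => s'; rewrite /coupling2; ring.
Qed.

Lemma energy_ge (c : R) u v x :
  (forall x s t, c * (h1 x * `|s| `^ p) + c * (h2 x * `|t| `^ q) <=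
    h1 x * (p^-1 * `|s| `^ p) + h2 x * (q^-1 * `|t| `^ q) -
    F x s t - l1 * (e1 x * s) - l2 * (e2 x * t) + B x) ->
  p^-1 * grad G u x `^ p + c * (h1 x * `|u x| `^ p) +
    (q^-1 * grad G v x `^ q + c * (h2 x * `|v x| `^ q)) <= energy u v x.
Proof.
move=> /(_ x (u x) (v x)) le; rewrite /energy /potential_energy /coupling1.
move: (c * (h1 x * _)) (c * (h2 x * _)) le => a1 a2.
move: (h1 x * (p^-1 * `|u x| `^ p)) (h2 x * (q^-1 * `|v x| `^ q)) => b1 b2.
move: (p^-1 * _) (q^-1 * _) => b3 b4 le.
by lra.
Qed.

End Coupled.

(** The slack is that of the bound on F plus (1-t) l (|e| |s| - e s), both nonnegative. [X], [Z] and
    [b] stand for whatever does not change when the active component is scaled. *)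
Lemma coupling_scale_le (R : realType) (X Fa Fb l e s t Z b P N : R) :
  0 < l -> t < 1 -> Fb - Fa <= (1 - t) * (P + N) ->
  X + (- Fa - l * (e * (t * s)) - Z + b) <= X + (- Fb - l * (e * s) - Z + b) +
    (1 - t) * (P + (l * (`|e| * `|s|) + N)).
Proof.
move=> l0 t1 FF; rewrite -subr_ge0.
rewrite (_ : _ - _ = ((1 - t) * (P + N) - (Fb - Fa)) +
  (1 - t) * (l * (`|e| * `|s| - e * s))); last by ring.
rewrite addr_ge0 ?subr_ge0// mulr_ge0 ?subr_ge0 ?(ltW t1)// mulr_ge0 ?(ltW l0)//.
by rewrite subr_ge0 -normrM ler_norm.
Qed.

(** * Existence, nontriviality and bounds for the system *)

Theorem theorem1p1 (R : realType) (V : choiceType) (G : wgraph R V)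
    (mu0 p q h0 : R) (h1 h2 e1 e2 : V -> R) (F : V -> R -> R -> R)
    (a : R -> R) (b f1 f2 g1 g2 : V -> R)
    (mu0_gt0 : 0 < mu0) (mu_ge : forall x, mu0 <= mu G x)
    (p_ge2 : 2 <= p) (q_ge2 : 2 <= q)
    (e1_L : inL G (p / (p - 1)) e1) (e2_L : inL G (q / (q - 1)) e2)
    (e1_neq0 : exists x, e1 x != 0) (e2_neq0 : exists x, e2 x != 0)
    (* (H1) *)
    (h0_gt0 : 0 < h0) (h1_ge : forall x, h0 <= h1 x)
    (h2_ge : forall x, h0 <= h2 x)
    (* (H2) *)
    (H2 : exists x0, coercive_potential G h1 x0 /\ coercive_potential G h2 x0)
    (* (F0) *)
    (F_C1 : C1_in_st F)
    (a_cont : {within `[0, +oo[%classic, continuous a})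
    (a_ge0 : forall r, 0 <= r -> 0 <= a r)
    (b_ge0 : forall x, 0 <= b x) (b_L1 : inL G 1 b)
    (Fs_ab : forall x s t, `|Fs F x s t| <= a (enorm s t) * b x)
    (Ft_ab : forall x s t, `|Ft F x s t| <= a (enorm s t) * b x)
    (F_ab : forall x s t, `|F x s t| <= a (enorm s t) * b x)
    (* (F1) *)
    (F_00 : forall x, F x 0 0 = 0)
    (f1_ge0 : forall x, 0 <= f1 x) (f2_ge0 : forall x, 0 <= f2 x)
    (g1_ge0 : forall x, 0 <= g1 x) (g2_ge0 : forall x, 0 <= g2 x)
    (g1_L : inL G (p / (p - 1)) g1) (g2_L : inL G (q / (q - 1)) g2)
    (f1_lt : (supnorm f1 <
              (Num.min (h0 / 2) (p * h0 / (q * (p - 1))))%:E)%E)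
    (f2_lt : (supnorm f2 <
              (h0 - q * (p - 1) / p * fine (supnorm f1))%:E)%E)
    (Fs_growth : forall x s t,
      `|Fs F x s t| <=
        f1 x * (`|s| `^ (p - 1) + `|t| `^ ((p * q - q) / p)) + g1 x)
    (Ft_growth : forall x s t,
      `|Ft F x s t| <= f2 x * (`|s| `^ p + `|t| `^ (q - 1)) + g2 x)
    (* (F2) *)
    (F2 :
      (exists (beta1 : R) (K1 : V -> R),
        [/\ 1 < beta1,
            exists x1, 0 < K1 x1 /\ 0 < e1 x1 &
            forall s x, - K1 x * `|s| `^ beta1 <= F x s 0]) \/
      (exists (beta2 : R) (K2 : V -> R),
        [/\ 1 < beta2,
            exists x2, 0 < K2 x2 /\ 0 < e2 x2 &
            forall t x, - K2 x * `|t| `^ beta2 <= F x 0 t])) :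
  forall lambda1 lambda2 : R, 0 < lambda1 -> 0 < lambda2 ->
  exists u v : V -> R,
    [/\ solution G p q h1 h2 e1 e2 F lambda1 lambda2 u v,
        (u, v) <> (cst 0, cst 0),
        v = cst 0 ->
        (supnorm u <=
          (mu0 `^ (- p^-1) *
           ((lambda1 * fine (LnormV G (p / (p - 1)) e1)
             + fine (LnormV G (p / (p - 1)) g1))
            / (h0 - fine (supnorm f1))) `^ (p - 1)^-1)%:E)%E &
        u = cst 0 ->
        (supnorm v <=
          (mu0 `^ (- q^-1) *
           ((lambda2 * fine (LnormV G (q / (q - 1)) e2)
             + fine (LnormV G (q / (q - 1)) g2))
            / (h0 - fine (supnorm f2))) `^ (q - 1)^-1)%:E)%E].
Proof.
move=> l1 l2 l10 l20.
have [x0 _] := H2.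
have p0 : 0 < p by lra.
have q0 : 0 < q by lra.
have p1 : 1 < p by lra.
have q1 : 1 < q by lra.
have [A1 [A1E A1_ge0 A1_lt f1A]] := supnormP x0 f1_ge0 f1_lt.
have [A2 [A2E A2_ge0 A2_lt f2A]] := supnormP x0 f2_ge0 f2_lt.
rewrite A1E A2E /= in A2_lt *.
have A1_lt2 : 2 * A1 < h0 by move: A1_lt; rewrite lt_min => /andP[? _]; lra.
have A2_lt' : q * (p - 1) / p * A1 + A2 < h0 by lra.
have A2_lt0 : A2 < h0.
  apply: le_lt_trans A2_lt'; rewrite lerDr mulr_ge0// divr_ge0 ?(ltW p0)//.
  by rewrite mulr_ge0 ?(ltW q0)// subr_ge0 ltW.
have FsA x s t : `|Fs F x s t| <=
    A1 * (`|s| `^ (p - 1) + `|t| `^ ((p * q - q) / p)) + g1 x.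
  apply: (le_trans (Fs_growth x s t)); rewrite lerD2r.
  by apply: ler_wpM2r; [rewrite addr_ge0 ?powR_ge0|exact: f1A].
have FtA x t : `|Ft F x 0 t| <= A2 * `|t| `^ (q - 1) + g2 x.
  apply: (le_trans (Ft_growth x 0 t)); rewrite normr0 powR0 ?gt_eqF// add0r lerD2r.
  by apply: ler_wpM2r; [exact: powR_ge0|exact: f2A].
have [c [B [c0 B0 Boo low]]] := exists_energy_shift p_ge2 q_ge2 h0_gt0 h1_ge h2_ge
  A1_ge0 A1_lt2 A2_ge0 A2_lt' l10 l20 g1_ge0 g2_ge0 e1_L e2_L g1_L g2_L F_C1 F_00 FsA FtA.
pose K := energy G p q l1 l2 h1 h2 e1 e2 B F.
have Klow (u v : V -> R) (x : V) := energy_ge G u v x low.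
have h1_0 x : 0 <= h1 x by apply: le_trans (h1_ge x); exact: ltW.
have h2_0 x : 0 <= h2 x by apply: le_trans (h2_ge x); exact: ltW.
have P1_0 (u : V -> R) x : 0 <= p^-1 * grad G u x `^ p by rewrite mulr_ge0 ?powR_ge0// invr_ge0 ltW.
have Q1_0 (v : V -> R) x : 0 <= q^-1 * grad G v x `^ q by rewrite mulr_ge0 ?powR_ge0// invr_ge0 ltW.
have P2_0 (u : V -> R) x : 0 <= c * (h1 x * `|u x| `^ p)
  by rewrite mulr_ge0 ?(ltW c0)// mulr_ge0 ?powR_ge0.
have Q2_0 (v : V -> R) x : 0 <= c * (h2 x * `|v x| `^ q)
  by rewrite mulr_ge0 ?(ltW c0)// mulr_ge0 ?powR_ge0.
have K_h1 (u v : V -> R) x : c * (h1 x * `|u x| `^ p) <= K u v x.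
  apply: le_trans (Klow u v x).
  by rewrite -addrA ler_wpDl ?P1_0// lerDl addr_ge0 ?Q1_0 ?Q2_0.
have K_h2 (u v : V -> R) x : c * (h2 x * `|v x| `^ q) <= K u v x.
  apply: le_trans (Klow u v x).
  by rewrite addrA lerDr addr_ge0 ?Q1_0// addr_ge0 ?P1_0 ?P2_0.
have K0 (u v : V -> R) x : 0 <= K u v x by exact: le_trans (P2_0 u x) (K_h1 u v x).
(* The gradient terms carry 1/p and 1/q, and the zero-order terms at least c h0 by (H1). *)
pose c' := Num.min (Num.min p^-1 q^-1) (c * h0).
have c'0 : 0 < c' by rewrite !lt_min !invr_gt0 p0 q0 mulr_gt0.
have c'p : c' <= p^-1 by rewrite /c' !ge_min lexx.
have c'q : c' <= q^-1 by rewrite /c' !ge_min lexx orbT.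
have c'h : c' <= c * h0 by rewrite /c' ge_min lexx orbT.
have Kge (u v : V -> R) x : c' * (dens G p u x + dens G q v x) <= K u v x.
  apply: le_trans (Klow u v x); rewrite mulrDr; apply: lerD; rewrite /dens mulrDr;
    apply: lerD; rewrite ?mulrA ler_wpM2r ?powR_ge0//.
    by apply: (le_trans c'h); rewrite ler_pM2l.
  by apply: (le_trans c'h); rewrite ler_pM2l.
have Kcont x : continuous (fun z : {ptws V -> R} * {ptws V -> R} => K z.1 z.2 x).
  apply: (@energy_continuous R V G p q l1 l2 h1 h2 e1 e2 B F
    ({ptws V -> R} * {ptws V -> R})%type fst snd p0 q0 F_C1) => y z.
    by apply: (@cvg_comp _ _ _ fst (fun w : {ptws V -> R} => w y) _ _ _ cvg_fst);
      exact: ptws_eval_continuous.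
  by apply: (@cvg_comp _ _ _ snd (fun w : {ptws V -> R} => w y) _ _ _ cvg_snd);
    exact: ptws_eval_continuous.
(* At the zero pair the energy density reduces to [B]. *)
have K00 : (gint G (K (cst 0%R) (cst 0%R)) < +oo)%E.
  rewrite (eq_gint G (g := B))// => x.
  have := dens0 G x p0; have := dens0 G x q0; rewrite /dens normr0 !powR0 ?gt_eqF// !addr0.
  rewrite /K /energy /potential_energy /coupling1 => -> ->.
  by rewrite /= normr0 !powR0 ?gt_eqF// F_00 !mulr0; ring.
have [u [v [au av Koo Kmin]]] :=
  exists_minimizer p_ge2 q_ge2 c'0 Kcont Kge K00.
have ci0 : 0 <= c^-1 by rewrite invr_ge0 ltW.
have [M KM] : exists M : R, (gint G (K u v) <= M%:E)%E by apply/gint_ubP.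
have uh1 : (gint G (fun x => h1 x * `|u x| `^ p)%R < +oo)%E.
  have le := gint_scale_le ci0 (le_trans (le_gint G (K_h1 u v)) KM).
  apply: le_lt_trans (ltry (c^-1 * M)); apply: le_trans le.
  by apply: le_gint => x; rewrite mulKf ?gt_eqF.
have vh2 : (gint G (fun x => h2 x * `|v x| `^ q)%R < +oo)%E.
  have le := gint_scale_le ci0 (le_trans (le_gint G (K_h2 u v)) KM).
  apply: le_lt_trans (ltry (c^-1 * M)); apply: le_trans le.
  by apply: le_gint => x; rewrite mulKf ?gt_eqF.
have hi0 : 0 <= h0^-1 by rewrite invr_ge0 ltW.
have u_p : (gint G (fun x => `|u x| `^ p)%R < +oo)%E.
  apply: le_lt_trans (gint_lty_scale hi0 _ uh1) => [|x]; last by rewrite mulr_ge0 ?powR_ge0.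
  by apply: le_gint => x; rewrite mulrA ler_peMl ?powR_ge0// mulrC ler_pdivlMr// mul1r.
have v_q : (gint G (fun x => `|v x| `^ q)%R < +oo)%E.
  apply: le_lt_trans (gint_lty_scale hi0 _ vh2) => [|x]; last by rewrite mulr_ge0 ?powR_ge0.
  by apply: le_gint => x; rewrite mulrA ler_peMl ?powR_ge0// mulrC ler_pdivlMr// mul1r.
have KE (u' v' : V -> R) : K u' v' = potential_energy G q h2
    (coupling2 G p l1 l2 h1 e1 e2 B F u') v' by exact: energyE.
have eq1 x : - pLaplacian G p u x + h1 x * `|u x| `^ (p - 2) * u x
    = Fs F x (u x) (v x) + l1 * e1 x.
  have der := is_derive_translate0
    (is_derive_coupling1 G q l1 l2 h2 e1 e2 B v x (u x) F_C1).
  have Emin t := Kmin _ _ (Cc_approx_add (Cc_dirac_at x t) au) av.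
  have := euler_lagrange p_ge2 (fun w y => K0 w v y) Koo Emin der.
  by move=> EL; apply/eqP; rewrite -subr_eq0 -EL; apply/eqP; ring.
have eq2 x : - pLaplacian G q v x + h2 x * `|v x| `^ (q - 2) * v x
    = Ft F x (u x) (v x) + l2 * e2 x.
  have der := is_derive_translate0
    (is_derive_coupling2 G p l1 l2 h1 e1 e2 B u x (v x) F_C1).
  apply/eqP; rewrite -subr_eq0; apply/eqP.
  rewrite -(@euler_lagrange _ _ G q h2 (coupling2 G p l1 l2 h1 e1 e2 B F u) v x _
    q_ge2 _ _ _ der); first by ring.
  - by move=> w y; rewrite -KE.
  - by rewrite -KE.
  - by move=> t; rewrite -!KE; exact: Kmin _ _ au (Cc_approx_add (Cc_dirac_at x t) av).
exists u, v; split.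
- split => //; split => //; exact: sobolev_of_Cc_approx.
- move=> [u0 v0]; rewrite u0 v0 in eq1 eq2.
  have lap0 r x : pLaplacian G r (cst 0) x = 0.
    rewrite /pLaplacian fsbig1 ?mulr0// => y _; by rewrite subrr mulr0.
  (* At the vertex given by (F2) the left side and the partial derivative of F both vanish, which
     would force a product of two positive numbers to be 0. *)
  case: F2 => [[b1 [K1 [b11 [x1 [K1x e1x]] low1]]]|[b2 [K2 [b21 [x2 [K2x e2x]] low2]]]].
    have := is_derive_eq0_of_powR_lower b11 (is_derive_Fs F_C1 x1 0 0) (F_00 x1)
      (fun s => low1 s x1).
    have := eq1 x1; rewrite lap0 /= mulr0 oppr0 addr0 => + F0; rewrite F0 add0r.
    by move/esym/eqP; rewrite mulf_eq0 !gt_eqF.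
  have := is_derive_eq0_of_powR_lower b21 (is_derive_Ft F_C1 x2 0 0) (F_00 x2)
    (fun s => low2 s x2).
  have := eq2 x2; rewrite lap0 /= mulr0 oppr0 addr0 => + F0; rewrite F0 add0r.
  by move/esym/eqP; rewrite mulf_eq0 !gt_eqF.
- move=> v0; rewrite v0 in Koo Kmin.
  apply: (supnorm_minimizer_le (h := h1)
    (Psi := coupling1 G q l1 l2 h2 e1 e2 B F (cst 0))) => //.
  + by lra.
  + by move=> w x; exact: (K0 w (cst 0)).
  + by move=> t; apply: Kmin; [exact: Cc_approx_scale|exact: Cc_approx0].
  move=> t x t0 t1; rewrite /coupling1 /=.
  (* With second argument 0 the mixed term disappears because its exponent q(p-1)/p is positive. *)
  have Fsd s : `|Fs F x s 0| <= A1 * `|s| `^ (p - 1) + g1 x.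
    apply: (le_trans (FsA x s 0)); rewrite normr0 powR0 ?addr0//.
    by rewrite gt_eqF// divr_gt0// -[X in _ - X]mul1r -mulrBl mulr_gt0// subr_gt0.
  have := primitive_scale_le (u x) p1 A1_ge0 (g1_ge0 x)
    (fun s => is_derive_Fs F_C1 x s 0) Fsd t0 t1.
  exact: coupling_scale_le.
- move=> u0; rewrite u0 in Koo Kmin.
  apply: (supnorm_minimizer_le (h := h2)
    (Psi := coupling2 G p l1 l2 h1 e1 e2 B F (cst 0))) => //.
  + by move=> w x; rewrite -KE; exact: (K0 (cst 0) w).
  + by rewrite -KE.
  + by move=> t; rewrite -!KE; apply: Kmin; [exact: Cc_approx0|exact: Cc_approx_scale].
  move=> t x t0 t1; rewrite /coupling2 /=.
  have := primitive_scale_le (v x) q1 A2_ge0 (g2_ge0 x)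
    (is_derive_Ft F_C1 x 0) (FtA x) t0 t1.
  (* The two source terms are swapped so that the one of the active component comes first. *)
  by rewrite ![_ - l1 * _ - _]addrAC; exact: coupling_scale_le.
Qed.
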